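(* Let $\Phi: G\times M\to M$ be a free and proper left action of a Lie group $G$ on a smooth manifold $M$, let $H: T^*M\to\mathbb{R}$ be a smooth Hamiltonian, let $\mathbf{J}: T^*M\to\mathfrak g^*$ be the momentum map of the cotangent-lifted action, and for $x\in M$ let $\mathcal{V}_x=T_x\mathcal{O}(x)$ be the tangent space to the group orbit $\mathcal{O}(x)$ through $x$. Suppose that 1. $H$ is $G$-invariant, i.e. $H\circ T^*\Phi_{g^{-1}}=H$ for all $g\in G$; 2. $\mathbb{F}H: T^*M\to TM$ is linear on each fiber and is non-degenerate on $\mathbf{J}^{-1}(0)$, i.e. for each $x\in M$ it is injective on the subspace $\mathbf{J}^{-1}(0)\cap T_x^*M$; 3. with $\mathcal{H}=\mathbb{F}H(\mathbf{J}^{-1}(0))\subset TM$ and $\mathcal{H}_x=\mathcal{H}\cap T_xM$, one has $\mathcal{H}_x\cap\mathcal{V}_x=0$ for every $x\in M$. Then $\mathcal{H}$ defines a principal connection on $\pi: M\to M/G$.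
   Context: $\mathbb{F}H: T^*M\to TM$ is the fiber derivative: $\langle\mathbb{F}H(\alpha_x),\beta_x\rangle=\frac{d}{d\varepsilon}\big|_{\varepsilon=0}H(\alpha_x+\varepsilon\beta_x)$ for $\alpha_x,\beta_x\in T_x^*M$. The momentum map is $\langle\mathbf{J}(\alpha_x),\xi\rangle=\langle\alpha_x,\xi_M(x)\rangle$ for $\xi\in\mathfrak g$, where $\mathfrak g$ is the Lie algebra of $G$ and $\xi_M$ the infinitesimal generator of $\xi$. $T^*\Phi_{g^{-1}}$ denotes the cotangent lift of $\Phi_g$, $\langle T^*\Phi_{g^{-1}}(\alpha_x),v\rangle=\langle\alpha_x,T\Phi_{g^{-1}}(v)\rangle$ for $v\in T_{\Phi_g(x)}M$. A principal connection on $\pi: M\to M/G$ is a distribution $\mathcal{H}\subset TM$ that is $G$-invariant, $T\Phi_g(\mathcal{H})=\mathcal{H}$ for all $g\in G$, and complements the vertical spaces, $T_xM=\mathcal{H}_x\oplus\mathcal{V}_x$ for all $x\in M$. *)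

(* Defs.v *)
From HB Require Import structures.
From mathcomp Require Import all_boot all_order all_algebra.
From mathcomp Require Import all_classical all_reals all_analysis.

Set Implicit Arguments.
Unset Strict Implicit.
Unset Printing Implicit Defensive.

Import Order.TTheory GRing.Theory Num.Theory.
Import numFieldNormedType.Exports.

Local Open Scope classical_set_scope.
Local Open Scope ring_scope.

(** * C^k and smooth functions on an open subset of a normed space *)

Section Smooth_functions.
Context {R : realType} {E F : normedModType R}.

(* Only meant for A open and E finite dimensional: there, f is C^(k+1) on A
   iff f is differentiable on A and all its directional derivatives are C^k.
   The values of f outside A are irrelevant. *)
Fixpoint Ck_on (k : nat) (A : set E) (f : E -> F) : Prop :=
  if k is k'.+1 then
    (forall x, A x -> differentiable f x) /\ (forall v, Ck_on k' A ('D_v f))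
  else forall x, A x -> {for x, continuous f}.

Definition smooth_on (A : set E) (f : E -> F) : Prop := forall k, Ck_on k A f.

End Smooth_functions.

(** * Charts and manifolds *)

(* A homeomorphism between an open subset of M and an open subset of E, given
   by two total functions, whose values outside of these sets are junk. *)
Record chart {R : realType} (M : topologicalType) (E : normedModType R) :=
  Chart {
    chart_fun :> M -> E;
    chart_inv : E -> M;
    chart_dom : set M;
    chart_cod : set E;
    chart_open_dom : open chart_dom;
    chart_open_cod : open chart_cod;
    chart_funP : forall x, chart_dom x -> chart_cod (chart_fun x);
    chart_invP : forall y, chart_cod y -> chart_dom (chart_inv y);
    chart_funK : forall x, chart_dom x -> chart_inv (chart_fun x) = x;
    chart_invK : forall y, chart_cod y -> chart_fun (chart_inv y) = y;
    chart_fun_continuous :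
      forall x, chart_dom x -> {for x, continuous chart_fun};
    chart_inv_continuous :
      forall y, chart_cod y -> {for y, continuous chart_inv} }.

(* The atlas is the family (chart_at x)_x, which has a preferred chart around
   every point.  Its compatibility is required in smooth_manifold below. *)
Record charted_space {R : realType} (E : normedModType R) := ChartedSpace {
  carrier :> topologicalType;
  chart_at : carrier -> chart carrier E;
  chart_at_dom : forall x, chart_dom (chart_at x) x }.

Record smooth_manifold (R : realType) (n : nat) := SmoothManifold {
  manifold_space :> charted_space 'rV[R]_n;
  manifold_compatible : forall a b : manifold_space,
    smooth_on [set y | chart_cod (chart_at a) y
                     /\ chart_dom (chart_at b) (chart_inv (chart_at a) y)]
              (fun y => chart_at b (chart_inv (chart_at a) y));
  manifold_hausdorff : hausdorff_space manifold_space;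
  manifold_second_countable : @second_countable manifold_space }.

Section Model_and_product.
Context {R : realType}.

Section Model.
Variable E : normedModType R.

Definition model_chart : chart E E.
Proof.
apply: (@Chart R E E id id setT setT) => //; first exact: openT.
- exact: openT.
- by move=> x _; exact: cvg_id.
- by move=> x _; exact: cvg_id.
Defined.

Definition model_space : charted_space E :=
  @ChartedSpace R E E (fun=> model_chart) (fun=> I).

End Model.

Section Product.
Variables (E F : normedModType R).

Lemma open_setX (T U : topologicalType) (A : set T) (B : set U) :
  open A -> open B -> open (A `*` B).
Proof.
rewrite !openE => oA oB [x y] [/= Ax By]; rewrite /interior /=.
by exists (A, B) => //; split; [exact: oA | exact: oB].
Qed.

Definition prod_chart (M N : topologicalType) (a : chart M E) (b : chart N F) :
  chart (M * N)%type (E * F)%type.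
Proof.
apply: (@Chart R (M * N)%type (E * F)%type
  (fun p => (a p.1, b p.2)) (fun q => (chart_inv a q.1, chart_inv b q.2))
  (chart_dom a `*` chart_dom b) (chart_cod a `*` chart_cod b)).
- by apply: open_setX; exact: chart_open_dom.
- by apply: open_setX; exact: chart_open_cod.
- by move=> -[x y] [/= ax bY]; split; exact: chart_funP.
- by move=> -[x y] [/= ax bY]; split; exact: chart_invP.
- by move=> -[x y] [/= ax bY]; rewrite !chart_funK.
- by move=> -[x y] [/= ax bY]; rewrite !chart_invK.
- move=> -[x y] [/= ax bY]; apply: cvg_pair => /=.
  + apply: (@cvg_comp _ _ _ fst a); first exact: cvg_fst.
    exact: chart_fun_continuous.
  + apply: (@cvg_comp _ _ _ snd b); first exact: cvg_snd.
    exact: chart_fun_continuous.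
- move=> -[x y] [/= ax bY]; apply: cvg_pair => /=.
  + apply: (@cvg_comp _ _ _ fst (chart_inv a)); first exact: cvg_fst.
    exact: chart_inv_continuous.
  + apply: (@cvg_comp _ _ _ snd (chart_inv b)); first exact: cvg_snd.
    exact: chart_inv_continuous.
Defined.

Definition prod_space (M : charted_space E) (N : charted_space F) :
    charted_space (E * F)%type :=
  @ChartedSpace R _ (M * N)%type
    (fun p => prod_chart (chart_at p.1) (chart_at p.2))
    (fun p => conj (chart_at_dom p.1) (chart_at_dom p.2)).

End Product.
End Model_and_product.

(** * Smooth maps and tangent maps *)

Unset Implicit Arguments.

Section Maps.
Context {R : realType} {E F : normedModType R}.
Context {M : charted_space E} {N : charted_space F}.

Definition local_expr (a : M) (b : N) (f : M -> N) : E -> F :=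
  fun y => chart_at b (f (chart_inv (chart_at a) y)).

(* Intended for U open. *)
Definition smooth_map_on (U : set M) (f : M -> N) : Prop :=
  (forall x, U x -> {for x, continuous f}) /\
  forall x, U x ->
    smooth_on [set y | chart_cod (chart_at x) y
                     /\ U (chart_inv (chart_at x) y)
                     /\ chart_dom (chart_at (f x)) (f (chart_inv (chart_at x) y))]
              (local_expr x (f x) f).

Definition smooth_map (f : M -> N) : Prop := smooth_map_on setT f.

End Maps.

(* T_xM is the model space E, a vector being represented by its coordinates in
   the preferred chart at x. *)
Definition tangent {R : realType} {E : normedModType R} {M : charted_space E}
  (x : M) : normedModType R := E.

Definition tangent_map {R : realType} {E F : normedModType R}
    {M : charted_space E} {N : charted_space F} (f : M -> N) (x : M) :
    tangent x -> tangent (f x) :=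
  'd (local_expr x (f x) f) (chart_at x x).

(* The coordinates of v in the chart chart_at c, for x in its domain. *)
Definition tangent_coord {R : realType} {E : normedModType R}
    {M : charted_space E} (c x : M) (v : tangent x) : E :=
  'd (local_expr x c id) (chart_at x x) v.

(* T^*_xM, the dual of row vectors being represented by column vectors. *)
Definition cotangent {R : realType} {n : nat} {M : charted_space 'rV[R]_n}
  (x : M) : normedModType R := 'cV[R]_n.

Section Cotangent.
Context {R : realType} {n : nat} {M : charted_space 'rV[R]_n}.

Definition pairing {x : M} (alpha : cotangent x) (v : tangent x) : R :=
  ((v : 'rV[R]_n) *m (alpha : 'cV[R]_n)) 0 0.

(* The covector representing the linear form l. *)
Definition covector {x : M} (l : tangent x -> R) : cotangent x :=
  \col_i l (delta_mx 0 i).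

(* The vector representing the linear form l on T^*_xM. *)
Definition bidual_vector {x : M} (l : cotangent x -> R) : tangent x :=
  \row_i l (delta_mx i 0).

(* The covector at x with coordinates p in the chart chart_at c. *)
Definition cotangent_of_coord (c x : M) (p : 'cV[R]_n) : cotangent x :=
  covector (fun v : tangent x => (tangent_coord c x v *m p) 0 0).

(* Smoothness on T^*M, in the bundle charts of T^*M induced by those of M. *)
Definition smooth_hamiltonian (H : forall x : M, cotangent x -> R) : Prop :=
  forall c : M,
    smooth_on (chart_cod (chart_at c) `*` [set: 'cV[R]_n])
      (fun q : 'rV[R]_n * 'cV[R]_n =>
         let x := chart_inv (chart_at c) q.1 in
         H x (cotangent_of_coord c x q.2)).

Definition fiber_derivative (H : forall x : M, cotangent x -> R) (x : M)
    (alpha : cotangent x) : tangent x :=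
  bidual_vector (fun beta : cotangent x =>
    derive1 (fun eps : R => H x (alpha + eps *: beta)) 0).

Lemma pairing_covector {x : M} (l : {linear tangent x -> R}) (v : tangent x) :
  pairing (covector l) v = l v.
Proof.
rewrite /pairing mxE [in RHS](row_sum_delta (v : 'rV[R]_n)) linear_sum.
by apply: eq_bigr => i _; rewrite linearZ mxE.
Qed.

Lemma fiber_derivativeP (H : forall x : M, cotangent x -> R) (x : M)
    (alpha beta : cotangent x) : differentiable (H x) alpha ->
  pairing beta (fiber_derivative H x alpha) =
  derive1 (fun eps : R => H x (alpha + eps *: beta)) 0.
Proof.
move=> dH.
have key (b : 'cV[R]_n) :
    derive1 (fun eps : R => H x (alpha + eps *: b)) 0 = 'd (H x) alpha b.
  rewrite -deriveE // /derive1 /derive.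
  set f := (X in lim (X @ _) = _); set g := (X in _ = lim (X @ _)).
  suff -> : f = g by [].
  by apply/funext => h; rewrite /f /g /= addr0 scale0r addr0 [alpha + _]addrC.
rewrite key /pairing mxE.
have betaE : (beta : 'cV[R]_n) = \sum_i (beta : 'cV[R]_n) i 0 *: delta_mx i 0.
  by rewrite [LHS]matrix_sum_delta; apply: eq_bigr => i _; rewrite big_ord1.
rewrite [in RHS]betaE linear_sum; apply: eq_bigr => i _.
by rewrite linearZ mxE key mulrC.
Qed.

End Cotangent.

(** * Lie groups and actions *)

Set Implicit Arguments.

Record lie_group (R : realType) (k : nat) := LieGroup {
  lie_manifold :> smooth_manifold R k;
  lie_one : lie_manifold;
  lie_mul : lie_manifold -> lie_manifold -> lie_manifold;
  lie_inv : lie_manifold -> lie_manifold;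
  lie_mulA : associative lie_mul;
  lie_mul1g : left_id lie_one lie_mul;
  lie_mulVg : left_inverse lie_one lie_inv lie_mul;
  lie_mul_smooth : smooth_map (M := prod_space lie_manifold lie_manifold)
    (N := lie_manifold) (fun p => lie_mul p.1 p.2);
  lie_inv_smooth : smooth_map (M := lie_manifold) (N := lie_manifold) lie_inv }.

Unset Implicit Arguments.

(* Only the underlying vector space, as the bracket is not needed. *)
Definition lie_algebra {R : realType} {k : nat} (G : lie_group R k) :
  normedModType R := tangent (lie_one G).

Section Actions.
Context {R : realType} {k n : nat} {G : lie_group R k} {M : smooth_manifold R n}.
Variable Phi : G -> M -> M.

Definition left_action : Prop :=
  (forall x, Phi (lie_one G) x = x) /\
  (forall g h x, Phi (lie_mul g h) x = Phi g (Phi h x)).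

Definition smooth_action : Prop :=
  smooth_map (M := prod_space G M) (N := M) (fun p => Phi p.1 p.2).

Definition free_action : Prop := forall g x, Phi g x = x -> g = lie_one G.

Definition proper_action : Prop := forall K : set (M * M),
  compact K -> compact [set p : G * M | K (Phi p.1 p.2, p.2)].

Definition group_orbit (x : M) : set M := range (Phi ^~ x).

(* xi_M(x) = T_e(g |-> Phi_g(x)) xi *)
Definition infinitesimal_generator (xi : lie_algebra G) (x : M) : tangent x :=
  tangent_map (M := G) (N := M) (Phi ^~ x) (lie_one G) xi.

Definition momentum_map (x : M) (alpha : cotangent x) : lie_algebra G -> R :=
  fun xi => pairing alpha (infinitesimal_generator xi x).

(* The fiber over x of J^{-1}(0). *)
Definition zero_momentum (x : M) : set (cotangent x) :=
  [set alpha | forall xi, momentum_map x alpha xi = 0].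

(* T^*Phi_{g^-1}; v and T Phi_{g^-1} v are tangent vectors at Phi_g(x) and x. *)
Definition cotangent_lift (g : G) (x : M) (alpha : cotangent x) :
    cotangent (Phi g x) :=
  covector (fun v : tangent (Phi g x) =>
    pairing alpha
      (tangent_map (M := M) (N := M) (Phi (lie_inv g)) (Phi g x) v : tangent x)).

Lemma cotangent_liftP (g : G) (x : M) (alpha : cotangent x)
    (v : tangent (Phi g x)) :
  pairing (cotangent_lift g x alpha) v =
  pairing alpha
    (tangent_map (M := M) (N := M) (Phi (lie_inv g)) (Phi g x) v : tangent x).
Proof.
rewrite /cotangent_lift.
set l := fun _ => _.
have ll : linear (l : 'rV[R]_n -> R^o).
  move=> a u w; rewrite /l /tangent_map /pairing linearP mulmxDl -scalemxAl.
  by rewrite !mxE.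
pose L := GRing.isLinear.Build R 'rV[R]_n R^o *:%R l ll.
exact: (pairing_covector (HB.pack_for {linear 'rV[R]_n -> R^o} l L) v).
Qed.

Definition invariant_hamiltonian (H : forall x : M, cotangent x -> R) : Prop :=
  forall g x (alpha : cotangent x),
    H (Phi g x) (cotangent_lift g x alpha) = H x alpha.

(* The fiber over x of FH(J^{-1}(0)); FH preserves fibers. *)
Definition horizontal (H : forall x : M, cotangent x -> R) (x : M) :
    set (tangent x) :=
  fiber_derivative H x @` zero_momentum x.

(* T_xS: the velocities at 0 of the smooth curves contained in S which are at x
   at time 0. *)
Definition tangent_to (S : set M) (x : M) : set (tangent x) :=
  [set v | exists (U : set R) (c : R -> M),
     [/\ open U, U 0, smooth_map_on (M := model_space R) (N := M) U c,
         forall t, U t -> S (c t)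
       & c 0 = x /\
         tangent_map (M := model_space R) (N := M) c (0 : R) (1 : R) = v]].

Definition vertical (x : M) : set (tangent x) := tangent_to (group_orbit x) x.

Definition tangent_distribution : Type := forall x : M, set (tangent x).

(* D is a smooth subbundle of TM: its rank r is constant, and it has a smooth
   local frame X_1, ..., X_r on a neighborhood of every point c. *)
Definition smooth_distribution (D : tangent_distribution) : Prop :=
  exists r : nat, forall c : M,
  exists (U : set M) (X : 'I_r -> forall x : M, tangent x),
    [/\ open U, U c, U `<=` chart_dom (chart_at c),
        forall i, smooth_on [set y | chart_cod (chart_at c) y
                                   /\ U (chart_inv (chart_at c) y)]
          (fun y => let x := chart_inv (chart_at c) y in
                    tangent_coord c x (X i x))
      & forall x, U x ->
          let F : 'M[R]_(r, n) := \matrix_i (X i x : 'rV[R]_n) in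
          row_free F /\ D x = [set v : 'rV[R]_n | (v <= F)%MS]].

Definition invariant_distribution (D : tangent_distribution) : Prop :=
  forall g x, tangent_map (M := M) (N := M) (Phi g) x @` D x = D (Phi g x).

(* T_xM is the direct sum of its subspaces A and B. *)
Definition direct_sum {x : M} (A B : set (tangent x)) : Prop :=
  A `&` B = [set 0] /\
  forall v : tangent x, exists a b, [/\ A a, B b & v = a + b].

Definition principal_connection (D : tangent_distribution) : Prop :=
  [/\ smooth_distribution D, invariant_distribution D
    & forall x, direct_sum (D x) (vertical x)].

End Actions.

(* Main.v *)
(* The only substantial point is that the generators of a free action do not
   vanish: all the J^-1(0)_x then have dimension n - k, and, FH being injective on
   them, so have the spaces H_x. As H_x meets trivially the k-dimensional space of
   the generators at x, which are vertical, the two span T_xM. The invariance of H_x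
   comes from the equivariance of FH and of the momentum map. A smooth frame of H
   is the image under FH of a polynomial frame of the kernel of the k x n matrix of
   the generators.

   Non-vanishing of generators usually relies on the exponential map. Instead, if
   xi generates 0 at x, then, by equivariance, the orbit map f : g |-> Phi_g(x) has
   the left translates of xi in the kernels of its differentials, and a compactness
   argument in a chart at the identity shows that f is not injective. *)

From HB Require Import structures.
Require Import Defs.
From mathcomp Require Import all_boot all_order all_algebra.
From mathcomp Require Import ring lra.
From mathcomp Require Import all_classical all_reals all_analysis.

Import Order.TTheory GRing.Theory Num.Theory.
Import numFieldNormedType.Exports.

Local Open Scope classical_set_scope.
Local Open Scope ring_scope.

(** * Calculus of C^k functions *)

Section Differential_calculus.
Local Set Implicit Arguments.
Local Unset Strict Implicit.
Context {R : realType}.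
Implicit Types E F W : normedModType R.

(** Vectors and covectors at [x] are coordinates in the preferred chart at [x], and this chart may
    change abruptly with [x]. The matrices of the generators and of FH at [x] are therefore not
    continuous in [x] in general: they serve for linear algebra at one point, while smoothness is
    proved for their versions in one fixed chart, tied to them by transition matrices. For the same
    reason, identities such as [Phi e x = x] have to be rewritten before the charts on both sides
    match.

    [Ck_on] only handles derivatives in constant directions. So every differential that has to vary
    smoothly (left translates of xi, generators, FH) is written as a derivative, in a constant
    direction, of one function of the base point and of the other variable.

    The frame of the kernel of A avoids division: near a point where A C = 1, the projection onto
    ker A along the image of C sends N to N - C (A C)^-1 A N; multiplying by det (A C) replaces the
    inverse by the adjugate. *)

Lemma near_eq_diff E F (f g : E -> F) (x : E) :
  (\near x, f x = g x) -> differentiable f x ->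
  differentiable g x /\ 'd g x = 'd f x :> (E -> F).
Proof.
move=> fg df.
have e : g \o shift x = cst (g x) + 'd f x +o_ 0 id.
  apply/eqaddoP => eps e0.
  have /diff_locally/eqaddoP/(_ _ e0) := df.
  have fgx : f x = g x by exact: nbhs_singleton fg.
  have fg0 : \forall y \near 0, f (y + x) = g (y + x).
    by move: fg; rewrite (near_shift 0 x) subr0.
  apply: filterS2 fg0 => y /= yfg.
  by rewrite /= /cst !fctE /= fgx yfg.
have cdf : continuous ('d f x) by exact: diff_continuous.
have E1 := diff_unique cdf e.
split; last exact: E1.
by apply/diff_locallyP; split; rewrite E1; [exact: cdf|exact: e].
Qed.

Lemma scale_bilinear E : bilinear_for
    (GRing.Scale.Law.clone _ _ *:%R _) (GRing.Scale.Law.clone _ _ *:%R _)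
    (fun (a : R) (v : E) => a *: v).
Proof.
split=> [u a x y|u a x y] /=.
- by rewrite scalerDl scalerA.
- by rewrite scalerDr !scalerA mulrC.
Qed.

Lemma is_diff_scale E F (f : E -> R) (g : E -> F) (x : E) :
  differentiable f x -> differentiable g x ->
  differentiable (fun y => f y *: g y) x /\
  forall v, 'd (fun y => f y *: g y) x v =
            f x *: 'd g x v + 'd f x v *: g x.
Proof.
move=> df dg.
pose B := bilinear_isBilinear.Build R R F F _ _ _ (@scale_bilinear F).
pose b : {bilinear R -> F -> F} := HB.pack (fun (a : R) (v : F) => a *: v) B.
have cb : continuous (fun p => b p.1 p.2).
  by move=> p; exact: scale_continuous.
have -> : (fun y => f y *: g y) =
    (fun p : R * F => b p.1 p.2) \o (fun y => (f y, g y)) by [].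
have dp := differentiable_pair df dg.
have dbp := differentiable_bilin (f x, g x) cb.
split; first exact: differentiable_comp.
move=> v; rewrite diff_comp //.
have -> := diff_bilin (f x, g x) cb.
by rewrite /comp; have -> := diff_pair df dg.
Qed.

End Differential_calculus.

(** * Closure properties of C^k functions *)

Section Ck_calculus.
Local Set Implicit Arguments.
Local Unset Strict Implicit.
Context {R : realType}.
Implicit Types E F W : normedModType R.

Lemma eq_Ck_on E F k (A : set E) (f g : E -> F) :
  open A -> (forall x, A x -> f x = g x) -> Ck_on k A f -> Ck_on k A g.
Proof.
move=> oA; elim: k f g => [|k IH] f g fg /=.
  move=> cf x Ax; have := cf _ Ax; rewrite /prop_for /continuous_at -fg //.
  apply: cvg_trans; apply: near_eq_cvg.
  by apply: filterS (open_nbhs_nbhs (conj oA Ax)) => y /fg.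
move=> [df Df]; have nfg x : A x -> \near x, f x = g x.
  by move=> Ax; apply: filterS (open_nbhs_nbhs (conj oA Ax)) => y /fg.
split=> [x Ax|v].
  by have [] := near_eq_diff (nfg _ Ax) (df _ Ax).
by apply: IH (Df v) => x Ax; exact: near_eq_derive (nfg _ Ax).
Qed.

Lemma sub_Ck_on E F k (A B : set E) (f : E -> F) :
  A `<=` B -> Ck_on k B f -> Ck_on k A f.
Proof.
move=> AB; elim: k f => [|k IH] f /= => [cf x /AB /cf //|[df Df]].
by split=> [x /AB /df //|v]; exact: IH.
Qed.

Lemma Ck_onW E F k (A : set E) (f : E -> F) : Ck_on k.+1 A f -> Ck_on k A f.
Proof.
elim: k f => [|k IH] f /= [df Df].
  by move=> x Ax; apply: differentiable_continuous; exact: df.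
by split=> // v; apply: IH; exact: Df.
Qed.

Lemma Ck_on_cst E F k (A : set E) (c : F) : Ck_on k A (fun=> c).
Proof.
elim: k c => [|k IH] c /=; first by move=> x _; exact: cvg_cst.
split=> [x _|v]; first exact: differentiable_cst.
rewrite (_ : 'D_v _ = fun=> 0) //; apply/funext => x; exact: derive_cst.
Qed.

Lemma Ck_on_add E F k (A : set E) (f g : E -> F) : open A ->
  Ck_on k A f -> Ck_on k A g -> Ck_on k A (fun x => f x + g x).
Proof.
move=> oA; elim: k f g => [|k IH] f g /=.
  by move=> cf cg x Ax; apply: cvgD; [exact: cf|exact: cg].
move=> [df Df] [dg Dg]; split=> [x Ax|v].
  by apply: differentiableD; [exact: df|exact: dg].
apply: eq_Ck_on (IH _ _ (Df v) (Dg v)) => // x Ax.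
by rewrite [RHS]deriveD //; apply: diff_derivable; [exact: df|exact: dg].
Qed.

Lemma Ck_on_sum E F k (A : set E) (I : Type) (r : seq I) (P : pred I)
    (f : I -> E -> F) : open A ->
  (forall i, P i -> Ck_on k A (f i)) ->
  Ck_on k A (fun x => \sum_(i <- r | P i) f i x).
Proof.
move=> oA Cf; elim: r => [|i r IH].
  by under eq_fun do rewrite big_nil; exact: Ck_on_cst.
under eq_fun do rewrite big_cons.
by case Pi: (P i); [apply: Ck_on_add => //; exact: Cf|exact: IH].
Qed.

Lemma Ck_on_linear E F W k (A : set E) (L : {linear F -> W}) (f : E -> F) :
  open A -> continuous L -> Ck_on k A f -> Ck_on k A (fun x => L (f x)).
Proof.
move=> oA cL; elim: k f => [|k IH] f /=.
  by move=> cf x Ax; apply: continuous_comp; [exact: cf|exact: cL].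
move=> [df Df]; split=> [x Ax|v].
  apply: (@differentiable_comp _ _ _ _ f L); first exact: df.
  exact: linear_differentiable.
apply: eq_Ck_on (IH _ (Df v)) => // x Ax.
have dL : differentiable L (f x) by exact: linear_differentiable.
rewrite [RHS]deriveE; last exact: (@differentiable_comp _ _ _ _ f L) (df _ Ax) _.
rewrite (@diff_comp _ _ _ _ f L) //=; last exact: df.
by rewrite diff_lin // deriveE //; exact: df.
Qed.

Lemma Ck_on_scale E F k (A : set E) (f : E -> R) (g : E -> F) : open A ->
  Ck_on k A f -> Ck_on k A g -> Ck_on k A (fun x => f x *: g x).
Proof.
move=> oA; elim: k f g => [|k IH] f g.
  by move=> /= cf cg x Ax; apply: cvgZ; [exact: cf|exact: cg].
move=> Cf Cg; have [df Df] := Cf; have [dg Dg] := Cg; split=> [x Ax|v].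
  by have [] := is_diff_scale (df _ Ax) (dg _ Ax).
have := Ck_on_add oA (IH _ _ (Ck_onW Cf) (Dg v)) (IH _ _ (Df v) (Ck_onW Cg)).
apply: eq_Ck_on => // x Ax.
have [ds es] := is_diff_scale (df _ Ax) (dg _ Ax).
by rewrite [RHS]deriveE // es !deriveE //; [exact: df|exact: dg].
Qed.

Lemma Ck_on_mul E k (A : set E) (f g : E -> R) : open A ->
  Ck_on k A f -> Ck_on k A g -> Ck_on k A (fun x => f x * g x).
Proof. exact: Ck_on_scale. Qed.

Lemma Ck_on_prod E k (A : set E) (I : Type) (r : seq I) (P : pred I)
    (f : I -> E -> R) : open A ->
  (forall i, P i -> Ck_on k A (f i)) ->
  Ck_on k A (fun x => \prod_(i <- r | P i) f i x).
Proof.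
move=> oA Cf; elim: r => [|i r IH].
  by under eq_fun do rewrite big_nil; exact: Ck_on_cst.
under eq_fun do rewrite big_cons.
by case Pi: (P i); [apply: Ck_on_mul => //; exact: Cf|exact: IH].
Qed.

(** What the chain rule needs of finite dimension: a varying direction splits along finitely many
    constant ones, with continuous linear coefficients. *)
Definition finite_coordinates (F : normedModType R) : Prop :=
  exists m (e : 'I_m -> F) (l : 'I_m -> {linear F -> R}),
    (forall i, continuous (l i)) /\ forall v, v = \sum_i l i v *: e i.

(** By the chain rule, the derivative of the composite is that of [g] in the direction ['D_v f x],
    which varies with [x]. Expanding this direction on the [e i] leaves only derivatives of [g] in
    constant directions, to which the induction hypothesis applies. *)
Lemma Ck_on_comp E F W k (A : set E) (B : set F) (f : E -> F) (g : F -> W) :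
  finite_coordinates F -> open A -> open B -> (forall x, A x -> B (f x)) ->
  Ck_on k A f -> Ck_on k B g -> Ck_on k A (fun x => g (f x)).
Proof.
move=> [m [e [l [lc le]]]] oA oB AB; elim: k g => [|k IH] g.
  by move=> /= cf cg x Ax; apply: continuous_comp; [exact: cf|exact/cg/AB].
move=> Cf [dg Dg]; have [df Df] := Cf; split=> [x Ax|v].
  by apply: differentiable_comp; [exact: df|exact/dg/AB].
have : Ck_on k A (fun x => \sum_i l i ('D_v f x) *: 'D_(e i) g (f x)).
  apply: Ck_on_sum => // i _; apply: Ck_on_scale => //.
    exact: (Ck_on_linear (L := l i) oA (lc i) (Df v)).
  exact: IH (Ck_onW Cf) (Dg (e i)).
apply: eq_Ck_on => // x Ax.
have dgx := dg _ (AB _ Ax).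
have dfx := df _ Ax.
rewrite [RHS](deriveE _ (differentiable_comp dfx dgx)) (diff_comp dfx dgx) /=.
rewrite -(deriveE v dfx).
rewrite [in RHS](le ('D_v f x)) linear_sum; apply: eq_bigr => i _.
by rewrite (deriveE _ dgx) linearZ.
Qed.

Lemma Ck_on_id E k (A : set E) : Ck_on k A (fun x : E => x).
Proof.
case: k => [|k] /=; first by move=> x _; exact: cvg_id.
split=> [x _|v]; first by apply: ex_diff.
by rewrite (_ : 'D_v _ = fun=> v);
  [exact: Ck_on_cst|apply/funext => x; exact: derive_id].
Qed.

Lemma continuous_inl E F : continuous (fun v : E => (v, 0 : F)).
Proof. by move=> v; apply: cvg_pair; [exact: cvg_id|exact: cvg_cst]. Qed.

Lemma continuous_inr E F : continuous (fun v : F => (0 : E, v)).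
Proof. by move=> v; apply: cvg_pair; [exact: cvg_cst|exact: cvg_id]. Qed.

Lemma Ck_on_pair E F W k (A : set E) (f : E -> F) (g : E -> W) : open A ->
  Ck_on k A f -> Ck_on k A g -> Ck_on k A (fun x => (f x, g x)).
Proof.
move=> oA Cf Cg.
have linl : linear (fun v : F => (v, 0 : W)).
  by move=> a u v; congr pair; rewrite /= scaler0 addr0.
have linr : linear (fun v : W => (0 : F, v)).
  by move=> a u v; congr pair; rewrite /= scaler0 addr0.
pose l : {linear F -> (F * W)%type} := HB.pack (fun v : F => (v, 0 : W))
  (GRing.isLinear.Build _ _ _ _ _ linl).
pose r : {linear W -> (F * W)%type} := HB.pack (fun v : W => (0 : F, v))
  (GRing.isLinear.Build _ _ _ _ _ linr).
have Cl := Ck_on_linear (L := l) oA (@continuous_inl F W) Cf.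
have Cr := Ck_on_linear (L := r) oA (@continuous_inr F W) Cg.
apply: eq_Ck_on (Ck_on_add oA Cl Cr) => // x _.
by congr pair; rewrite /= (addr0, add0r).
Qed.

Lemma Ck_on_coord E k (A : set E) m n (f : E -> 'M[R]_(m, n)) i j : open A ->
  Ck_on k A f -> Ck_on k A (fun x => f x i j).
Proof.
move=> oA Cf.
have lin : linear (fun N : 'M[R]_(m, n) => N i j : R).
  by move=> a u v; rewrite !mxE.
pose l : {linear 'M[R]_(m, n) -> R} := HB.pack (fun N : 'M[R]_(m, n) => N i j : R)
  (GRing.isLinear.Build _ _ _ _ _ lin).
exact: (Ck_on_linear (L := l) oA (@coord_continuous _ _ _ i j) Cf).
Qed.

Lemma Ck_on_mx E k (A : set E) m n (f : E -> 'M[R]_(m, n)) : open A ->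
  (forall i j, Ck_on k A (fun x => f x i j)) -> Ck_on k A f.
Proof.
move=> oA Cf.
rewrite (_ : f = fun x => \sum_i \sum_j f x i j *: delta_mx i j); last first.
  by apply/funext => x; rewrite -matrix_sum_delta.
apply: Ck_on_sum => // i _; apply: Ck_on_sum => // j _.
by apply: Ck_on_scale => //; exact: Ck_on_cst.
Qed.

Lemma Ck_on_det E k (A : set E) m (f : E -> 'M[R]_m) : open A ->
  Ck_on k A f -> Ck_on k A (fun x => \det (f x)).
Proof.
move=> oA Cf; rewrite /determinant; apply: Ck_on_sum => // s _.
apply: Ck_on_mul => //; first exact: Ck_on_cst.
by apply: Ck_on_prod => // i _; exact: Ck_on_coord.
Qed.

Lemma Ck_on_adj E k (A : set E) m (f : E -> 'M[R]_m) : open A ->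
  Ck_on k A f -> Ck_on k A (fun x => \adj (f x)).
Proof.
move=> oA Cf; apply: Ck_on_mx => // i j.
rewrite (_ : (fun _ => _) = (fun x => (-1) ^+ (j + i) *
   \det (row' j (col' i (f x))))); last by apply/funext => x; rewrite mxE.
apply: Ck_on_mul => //; first exact: Ck_on_cst.
apply: Ck_on_det => //; apply: Ck_on_mx => // i' j'.
rewrite (_ : (fun _ => _) = (fun x => f x (lift j i') (lift i j'))).
  exact: Ck_on_coord.
by apply/funext => x; rewrite !mxE.
Qed.

Lemma finite_coordinates_mx m n : finite_coordinates 'M[R]_(m, n).
Proof.
have lin (i : 'I_#|{: 'I_m * 'I_n}|) :
    linear (fun N : 'M[R]_(m, n) => N (enum_val i).1 (enum_val i).2 : R).
  by move=> a u v; rewrite !mxE.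
exists #|{: 'I_m * 'I_n}|.
exists (fun i => delta_mx (enum_val i).1 (enum_val i).2).
pose l i : {linear 'M[R]_(m, n) -> R} := HB.pack
  (fun N : 'M[R]_(m, n) => N (enum_val i).1 (enum_val i).2 : R)
  (GRing.isLinear.Build _ _ _ _ _ (lin i)).
exists l.
split=> [i|v]; first exact: coord_continuous.
rewrite [LHS]matrix_sum_delta pair_bigA /=.
rewrite (reindex (@enum_val _ {: 'I_m * 'I_n})) //=.
by apply: onW_bij; exact: enum_val_bij.
Qed.

Lemma finite_coordinates_prod E F : finite_coordinates E ->
  finite_coordinates F -> finite_coordinates (E * F)%type.
Proof.
move=> [m [e [l [lc le]]]] [n [f [r [rc rf]]]].
pose c (i : 'I_(m + n)) (p : E * F) : R :=
  match fintype.split i with inl j => l j p.1 | inr j => r j p.2 end.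
have clin i : linear (c i).
  by move=> a u v; rewrite /c; case: fintype.split => j /=; rewrite linearP.
exists (m + n)%N.
exists (fun i => match fintype.split i with
  inl j => (e j, 0) | inr j => (0, f j) end).
pose cl i : {linear (E * F)%type -> R} :=
  HB.pack (c i) (GRing.isLinear.Build _ _ _ _ _ (clin i)).
exists cl.
split=> [i|[u v]].
  rewrite /= /c; case: fintype.split => j p.
    by apply: (continuous_comp (f := fst) (g := l j)); [exact: cvg_fst|exact: lc].
  by apply: (continuous_comp (f := snd) (g := r j)); [exact: cvg_snd|exact: rc].
rewrite big_split_ord /= /c.
under eq_bigr do rewrite (unsplitK (inl _)) /=.
under [X in _ = _ + X]eq_bigr do rewrite (unsplitK (inr _)) /=.
have -> : \sum_i l i u *: (e i, 0 : F) = (u, 0).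
  rewrite [in RHS](le u); elim/big_rec2: _ => // i y1 y2 _ ->.
  by congr pair; rewrite /= scaler0 addr0.
have -> : \sum_i r i v *: (0 : E, f i) = (0, v).
  rewrite [in RHS](rf v); elim/big_rec2: _ => // i y1 y2 _ ->.
  by congr pair; rewrite /= scaler0 addr0.
by congr pair; rewrite /= (addr0, add0r).
Qed.

End Ck_calculus.

(** * Maps in charts *)

Section Charts.
Local Set Implicit Arguments.
Local Unset Strict Implicit.
Context {R : realType}.
Implicit Types E F W : normedModType R.

Lemma near_chart_inv E (M : charted_space E) (a x : M) (P : set M) :
  chart_dom (chart_at a) x -> (\near x, P x) ->
  \forall y \near chart_at a x,
    chart_cod (chart_at a) y /\ P (chart_inv (chart_at a) y).
Proof.
move=> ax Px; have cax := chart_funP ax.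
apply: filterI; first by apply: open_nbhs_nbhs; split; [exact: chart_open_cod|].
by apply: (chart_inv_continuous cax); rewrite chart_funK.
Qed.

Lemma near_chart_dom E (M : charted_space E) (a x : M) :
  chart_dom (chart_at a) x -> \near x, chart_dom (chart_at a) x.
Proof. by move=> ax; apply: open_nbhs_nbhs; split => //; exact: chart_open_dom. Qed.

Lemma open_chart_preimage E (M : charted_space E) (a : M) (U : set M) :
  open U ->
  open [set y | chart_cod (chart_at a) y /\ U (chart_inv (chart_at a) y)].
Proof.
move=> oU; rewrite openE => y [cy Uy].
have dy := chart_invP cy; rewrite /interior -(chart_invK cy).
by apply: near_chart_inv => //; exact: open_nbhs_nbhs.
Qed.

Lemma open_map_preimage E F (M : charted_space E) (N : charted_space F)
    (f : M -> N) (U : set M) (V : set N) :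
  open U -> open V -> (forall x, U x -> {for x, continuous f}) ->
  open [set x | U x /\ V (f x)].
Proof.
move=> oU oV cf; rewrite openE => x [Ux Vfx].
apply: filterI; first exact: open_nbhs_nbhs.
by apply: (cf _ Ux); exact: open_nbhs_nbhs.
Qed.

(** Going through the chart at [b] gives the local expression of the composite only near
    [chart_at a x]: farther away [f] may leave the domain of that chart, where its values are junk.
    With [g := id] this is a change of charts. *)
Lemma local_expr_comp E F W (M : charted_space E) (N : charted_space F)
    (P : charted_space W) (f : M -> N) (g : N -> P) (a x : M) (b : N) (c : P) :
  chart_dom (chart_at a) x -> chart_dom (chart_at b) (f x) ->
  {for x, continuous f} ->
  differentiable (local_expr a b f) (chart_at a x) ->
  differentiable (local_expr b c g) (chart_at b (f x)) ->
  differentiable (local_expr a c (fun y => g (f y))) (chart_at a x) /\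
  forall v, 'd (local_expr a c (fun y => g (f y))) (chart_at a x) v =
    'd (local_expr b c g) (chart_at b (f x))
      ('d (local_expr a b f) (chart_at a x) v).
Proof.
move=> ax bfx cf df dg.
have e : local_expr a b f (chart_at a x) = chart_at b (f x).
  by rewrite /local_expr chart_funK.
have dg' : differentiable (local_expr b c g) (local_expr a b f (chart_at a x)).
  by rewrite e.
have dgf := differentiable_comp df dg'.
have fg : \forall y \near chart_at a x,
    (local_expr b c g \o local_expr a b f) y =
    local_expr a c (fun y => g (f y)) y.
  have nb : \near x, chart_dom (chart_at b) (f x).
    by apply: cf; exact: near_chart_dom.
  apply: filterS (near_chart_inv ax nb) => y [cy dy].
  by rewrite /local_expr /= chart_funK.
have [d1 ->] := near_eq_diff fg dgf; split => // v.
by rewrite (diff_comp df dg') /= e.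
Qed.

Lemma local_expr_id_diff n (M : smooth_manifold R n) (a b x : M) :
  chart_dom (chart_at a) x -> chart_dom (chart_at b) x ->
  differentiable (local_expr a b (@id M)) (chart_at a x).
Proof.
move=> ax bx; have [/= h _] := manifold_compatible a b 1%N.
by apply: h; rewrite chart_funK //; split => //; exact: chart_funP.
Qed.

Lemma continuous_at_id (T : topologicalType) (x : T) : {for x, continuous id}.
Proof. exact: cvg_id. Qed.

Lemma local_expr_id_same E (M : charted_space E) (x a : M) (v : E) :
  chart_dom (chart_at a) x ->
  'd (local_expr a a (@id M)) (chart_at a x) v = v.
Proof.
move=> ax.
have fg : \forall y \near chart_at a x, id y = local_expr a a id y.
  apply: filterS (near_chart_inv ax (near_chart_dom ax)) => y [cy _].
  by rewrite /local_expr /= chart_invK.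
have [_ ->] := near_eq_diff fg (@ex_diff _ _ _ _ _ _ _ (is_diff_id _)).
by rewrite diff_val.
Qed.

Section Partial_maps.
Variables (E F W : normedModType R).
Variables (M : charted_space E) (N : charted_space F) (P : charted_space W).
Variable f : M -> N -> P.
Let uf : prod_space M N -> P := fun p => f p.1 p.2.
Hypothesis f_smooth : smooth_map (M := prod_space M N) (N := P) uf.

(** The center [z] of the target chart is separate from [f x y], so that the chart at [e] can be
    used for [mul e e], or the one at [x] for [Phi e x]. *)
Definition prod_expr (x : M) (y : N) (z : P) (q : E * F) : W :=
  chart_at z (f (chart_inv (chart_at x) q.1) (chart_inv (chart_at y) q.2)).

Definition prod_expr_dom (x : M) (y : N) (z : P) : set (E * F) :=
  [set q | [/\ chart_cod (chart_at x) q.1, chart_cod (chart_at y) q.2 &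
    chart_dom (chart_at z)
      (f (chart_inv (chart_at x) q.1) (chart_inv (chart_at y) q.2))]].

Lemma open_prod_expr_dom x y z : open (prod_expr_dom x y z).
Proof.
have := @open_chart_preimage _ (prod_space M N) (x, y)
  [set p | setT p /\ chart_dom (chart_at z) (uf p)].
have o : open [set p : prod_space M N | setT p /\ chart_dom (chart_at z) (uf p)].
  apply: open_map_preimage; [exact: openT|exact: chart_open_dom|].
  by have [] := f_smooth.
move=> /(_ o); congr open; apply/seteqP; split => q /=.
  by move=> [[? ?] [_ ?]]; split.
by move=> [? ? ?]; split.
Qed.

Lemma prod_expr_smooth x y z : f x y = z ->
  smooth_on (prod_expr_dom x y z) (prod_expr x y z).
Proof.
move=> <- k; have [_ /(_ (x, y) I k)] := f_smooth.
by apply: sub_Ck_on => q [? ? ?].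
Qed.

Lemma prod_expr_dom_chart x y z x' y' :
  chart_dom (chart_at x) x' -> chart_dom (chart_at y) y' ->
  chart_dom (chart_at z) (f x' y') ->
  prod_expr_dom x y z (chart_at x x', chart_at y y').
Proof.
by move=> dx dy dz; split; rewrite /= ?chart_funK //; exact: chart_funP.
Qed.

Lemma prod_expr_diff x y z x' y' : f x y = z ->
  chart_dom (chart_at x) x' -> chart_dom (chart_at y) y' ->
  chart_dom (chart_at z) (f x' y') ->
  differentiable (prod_expr x y z) (chart_at x x', chart_at y y').
Proof.
move=> fxy dx dy dz; have [h _] := prod_expr_smooth fxy 1%N.
by apply: h; exact: prod_expr_dom_chart.
Qed.

Lemma continuous_partial_l y : continuous (f^~ y).
Proof.
move=> x; apply: (continuous_comp (f := fun x => (x, y)) (g := uf)).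
  by apply: cvg_pair; [exact: cvg_id|exact: cvg_cst].
by have [/(_ _ I)] := f_smooth.
Qed.

Lemma continuous_partial_r x : continuous (f x).
Proof.
move=> y; apply: (continuous_comp (f := fun y => (x, y)) (g := uf)).
  by apply: cvg_pair; [exact: cvg_cst|exact: cvg_id].
by have [/(_ _ I)] := f_smooth.
Qed.

(** The right-hand side is a derivative of one fixed function in a constant direction, so its
    dependence on [x'] and [y'] is controlled by the joint smoothness of [f]. *)
Lemma local_expr_partial_l x y z x' y' : f x y = z ->
  chart_dom (chart_at x) x' -> chart_dom (chart_at y) y' ->
  chart_dom (chart_at z) (f x' y') ->
  differentiable (local_expr x z (f^~ y')) (chart_at x x') /\
  forall v, 'd (local_expr x z (f^~ y')) (chart_at x x') v =
    'D_(v, 0) (prod_expr x y z) (chart_at x x', chart_at y y').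
Proof.
move=> fxy dx dy dz.
have -> : local_expr x z (f^~ y') =
    prod_expr x y z \o (fun a => (a, chart_at y y')).
  by apply/funext => a; rewrite /local_expr /prod_expr /= chart_funK.
have d1 := prod_expr_diff fxy dx dy dz.
have d2 : differentiable (fun a => (a, chart_at y y')) (chart_at x x').
  apply: differentiable_pair; [exact: ex_diff|exact: differentiable_cst].
split; first exact: differentiable_comp.
move=> v; rewrite diff_comp // deriveE //=; congr ('d _ _ _).
have -> := diff_pair (@ex_diff _ _ _ _ _ _ _ (is_diff_id (chart_at x x')))
  (differentiable_cst (chart_at y y') (chart_at x x')).
by rewrite diff_cst diff_val.
Qed.

Lemma local_expr_partial_r x y z x' y' : f x y = z ->
  chart_dom (chart_at x) x' -> chart_dom (chart_at y) y' ->
  chart_dom (chart_at z) (f x' y') ->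
  differentiable (local_expr y z (f x')) (chart_at y y') /\
  forall v, 'd (local_expr y z (f x')) (chart_at y y') v =
    'D_(0, v) (prod_expr x y z) (chart_at x x', chart_at y y').
Proof.
move=> fxy dx dy dz.
have -> : local_expr y z (f x') =
    prod_expr x y z \o (fun a => (chart_at x x', a)).
  by apply/funext => a; rewrite /local_expr /prod_expr /= chart_funK.
have d1 := prod_expr_diff fxy dx dy dz.
have d2 : differentiable (fun a => (chart_at x x', a)) (chart_at y y').
  apply: differentiable_pair; [exact: differentiable_cst|exact: ex_diff].
split; first exact: differentiable_comp.
move=> v; rewrite diff_comp // deriveE //=; congr ('d _ _ _).
have -> := diff_pair (differentiable_cst (chart_at x x') (chart_at y y'))
  (@ex_diff _ _ _ _ _ _ _ (is_diff_id (chart_at y y'))).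
by rewrite diff_cst diff_val.
Qed.

End Partial_maps.

End Charts.

(** * Non-vanishing of the generators of a free action *)

Section Kernel_directions.
Local Set Implicit Arguments.
Local Unset Strict Implicit.
Context {R : realType} {n : nat} {F : normedModType R}.

Lemma continuous_dist (V : normedModType R) (a : V) :
  continuous (fun b : V => `|b - a|).
Proof.
by move=> b; apply: cvg_norm; apply: cvgB; [exact: cvg_id|exact: cvg_cst].
Qed.

(** Covers both closed balls and spheres. *)
Lemma compact_norm_le (a : 'rV[R]_n) (A : set R) : closed A -> has_ubound A ->
  compact [set b : 'rV[R]_n | A `|b - a|].
Proof.
move=> cA [r rA].
have cn : continuous (fun b : 'rV[R]_n => `|b - a|).
  exact: (@continuous_dist 'rV[R]_n).
apply: bounded_closed_compact; last by apply: closed_comp => // b _; exact: cn.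
exists (`|a| + `|r|); split; first exact: num_real.
move=> y ry b /rA br; apply: le_trans (ltW ry).
rewrite -[b](subrK a) addrC (le_trans (ler_normD _ _)) // lerD2l.
exact: le_trans br (ler_norm _).
Qed.

(* On a small closed ball, maximize l(a) - K |f a - f a0|, where l is a linear
   form positive on the kernel directions v a. For K large, the maximum is not on
   the boundary, as f only takes the value f a0 at a0; but inside the ball, moving
   in the direction v a increases this function to first order. *)
Lemma kernel_directions_not_injective (f : 'rV[R]_n -> F) (a0 : 'rV[R]_n)
    (v : 'rV[R]_n -> 'rV[R]_n) :
  (\forall a \near a0, {for a, continuous f}) ->
  (\forall a \near a0, differentiable f a /\ 'd f a (v a) = 0) ->
  (\forall a \near a0, f a = f a0 -> a = a0) ->
  {for a0, continuous v} -> v a0 = 0.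
Proof.
move=> cf df injf cv; apply: contrapT => v0.
(* Pairing with [v a0] itself makes [l (v a0)] a sum of squares, positive unless [v a0 = 0]. *)
pose l (w : 'rV[R]_n) : R := \sum_i v a0 0 i * w 0 i.
have lD u w : l (u + w) = l u + l w.
  by rewrite -big_split; apply: eq_bigr => i _; rewrite mxE mulrDr.
have lZ c w : l (c *: w) = c * l w.
  by rewrite mulr_sumr; apply: eq_bigr => i _; rewrite mxE mulrCA.
have lc : continuous l.
  suff : Ck_on 0 setT l by move=> h w; exact: h.
  have oT := @openT 'rV[R]_n.
  apply: Ck_on_sum => // i _; apply: Ck_on_mul => //; first exact: Ck_on_cst.
  by apply: Ck_on_coord => //; exact: Ck_on_id.
have lv0 : 0 < l (v a0).
  rewrite lt_neqAle sumr_ge0 ?andbT => [|i _]; last exact: sqr_ge0.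
  apply/eqP => /esym /psumr_eq0P l0; apply: v0; apply/rowP => i.
  have /eqP := l0 (fun i _ => sqr_ge0 _) i isT.
  by rewrite mulf_eq0 orbb mxE => /eqP.
have lv : \forall a \near a0, 0 < l (v a).
  have clv : {for a0, continuous (l \o v)} by apply: continuous_comp => //; exact: lc.
  by have /cvgr_gt := clv; apply.
have [r r0 hr] : exists2 r, 0 < r & forall a, `|a - a0| <= r ->
    [/\ {for a, continuous f}, differentiable f a, 'd f a (v a) = 0,
        f a = f a0 -> a = a0 & 0 < l (v a)].
  have [e /= e0 he] := (nbhs_normP _ _).1 (filterI (filterI cf df) (filterI injf lv)).
  exists (e / 2); first by rewrite divr_gt0.
  move=> a ae; have [|[h1 [h2 h3]] [h4 h5]] := he a.
    by rewrite /= distrC (le_lt_trans ae) // ltr_pdivrMr // ltr_pMr // ltr1n.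
  by split.
pose B := [set a : 'rV[R]_n | `|a - a0| <= r].
pose S := [set a : 'rV[R]_n | `|a - a0| = r].
have cB : compact B.
  by apply: (@compact_norm_le a0 [set x | x <= r]); [exact: closed_le|exists r].
have cS : compact S.
  by apply: (@compact_norm_le a0 [set x | x = r]);
    [exact: closed_eq|exists r => x ->].
have Ba0 : B a0 by rewrite /B /= subrr normr0 ltW.
have SB a : S a -> B a by rewrite /S /B /= => ->.
pose d a := `|f a - f a0|.
have dcont a : B a -> {for a, continuous d}.
  move=> Ba; apply: (continuous_comp (g := fun z => `|z - f a0|)).
    by have [] := hr _ Ba.
  exact: continuous_dist.
(* The minimum of [d] on the sphere is positive by local injectivity. The sphere is empty when
   [n = 0], and any positive number then works. *)
have [delta delta0 hd] : exists2 e, 0 < e & forall a, S a -> e <= d a.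
  have [S0|/nonemptyPn S0] := pselect (S !=set0); last first.
    by exists 1 => // a; rewrite S0.
  have cd : {within S, continuous d}.
    by apply: continuous_in_subspaceT => a; rewrite inE => /SB /dcont.
  have [c] := EVT_min_rV S0 cS cd; rewrite inE => Sc hc.
  exists (d c) => [|a Sa]; last by apply: hc; rewrite inE.
  rewrite normr_gt0 subr_eq0; apply/eqP => fc.
  have [_ _ _ /(_ fc) ca _] := hr _ (SB _ Sc).
  by move: Sc; rewrite /S /= ca subrr normr0 => /eqP; rewrite lt_eqF.
have lca : continuous (fun a : 'rV[R]_n => l (a - a0)).
  rewrite (_ : (fun _ => _) = fun a => l a + cst (l (- a0)) a); last first.
    by apply/funext => a; rewrite lD.
  by move=> a; apply: continuousD; [exact: lc|exact: cst_continuous].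
have l0 : l 0 = 0 by rewrite -[X in l X](scale0r (0 : 'rV_n)) lZ mul0r.
have [C C0 hC] : exists2 C, 0 <= C & forall a, B a -> l (a - a0) <= C.
  have cl : {within B, continuous (fun a : 'rV[R]_n => l (a - a0))}.
    exact: continuous_subspaceT.
  have [c _ hc] := EVT_max_rV (ex_intro _ _ Ba0) cB cl.
  exists (l (c - a0)) => [|a Ba]; last by apply: hc; rewrite inE.
  by rewrite -[X in X <= _]l0 -(subrr a0); apply: hc; rewrite inE.
(* As [K * delta = C + 1] exceeds [l (a - a0)] on the ball, [u] is negative on the sphere, whereas
   [u a0 = 0]. *)
pose K := (C + 1) / delta.
have K0 : 0 < K by rewrite divr_gt0 // ltr_wpDl.
pose u a := l (a - a0) - K * d a.
have ua0 : u a0 = 0 by rewrite /u /d !subrr normr0 l0 mulr0 subrr.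
have [c] : exists2 c, c \in B & forall t, t \in B -> u t <= u c.
  apply: EVT_max_rV => //; first by exists a0.
  apply: continuous_in_subspaceT => a; rewrite inE => Ba.
  have := @continuousM R _ (cst K) d a (@cst_continuous _ _ K a) (dcont _ Ba).
  exact: continuousB (lca a).
rewrite inE => Bc hc.
have uc : 0 <= u c by rewrite -ua0; apply: hc; rewrite inE.
have {uc} rc : `|c - a0| < r.
  rewrite lt_neqAle Bc andbT; apply/eqP => Sc; move: uc; apply/negP.
  rewrite -ltNge /u subr_lt0 (le_lt_trans (hC _ Bc)) //.
  have KC : C < K * delta by rewrite /K divfK ?gt_eqF // ltrDl.
  by apply: lt_le_trans KC _; rewrite ler_pM2l // hd.
have [_ dfc Dfc _ lvc] := hr _ Bc.
have Dc : derivable f c (v c) by exact: diff_derivable.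
(* The difference quotients of [f] at [c] along [v c] tend to 0, so they end up below [e]. The
   penalty then grows by at most [K * h * e], half of the gain [h * l (v c)]. *)
pose e := l (v c) / (2 * K).
have e0 : 0 < e by rewrite divr_gt0 // mulr_gt0.
have ne : \forall h \near 0^', `|h^-1 *: (f (h *: v c + c) - f c)| <= e.
  have := Dc; rewrite /derivable => /cvg_ex[L hL].
  have L0 : L = 0 by rewrite -Dfc -deriveE //; apply/esym/cvg_lim.
  by move: hL; rewrite L0 => /cvgr0Pnorm_le; exact.
have nB : \forall h \near 0^', B (h *: v c + c).
  apply: cvg_within.
  have cw : {for 0, continuous (fun h : R => h *: v c + c)}.
    apply: cvgD; last exact: cvg_cst.
    by apply: cvgZ; [exact: cvg_id|exact: cvg_cst].
  have cn : {for 0, continuous (fun h : R => `|h *: v c + c - a0|)}.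
    apply: (continuous_comp (g := fun z : 'rV[R]_n => `|z - a0|)) => //.
    exact: (@continuous_dist 'rV[R]_n).
  have := cn; rewrite /prop_for /continuous_at scale0r add0r => /cvgr_lt /(_ _ rc).
  by apply: filterS => h /ltW.
have [h [h0 [hB he]]] : exists h : R, 0 < h /\ B (h *: v c + c) /\
    `|h^-1 *: (f (h *: v c + c) - f c)| <= e.
  have /nbhs_ballP[eps /= eps0 heps] : nbhs (0 : R) (fun h => h != 0 ->
      B (h *: v c + c) /\ `|h^-1 *: (f (h *: v c + c) - f c)| <= e).
    exact: filterI nB ne.
  have h0 : 0 < eps / 2 by rewrite divr_gt0.
  exists (eps / 2); split => //; apply: heps; last by rewrite gt_eqF.
  by rewrite /ball /= sub0r normrN gtr0_norm // ltr_pdivrMr // ltr_pMr // ltr1n.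
have := hc (h *: v c + c); rewrite inE => /(_ hB); apply/negP; rewrite -ltNge.
have fd : d (h *: v c + c) <= d c + h * e.
  have := ler_normD (f (h *: v c + c) - f c) (f c - f a0).
  rewrite subrKA => /le_trans; apply; rewrite addrC lerD2l.
  by move: he; rewrite normrZ normfV (gtr0_norm h0) ler_pdivrMl.
have lE : l (h *: v c + c - a0) = h * l (v c) + l (c - a0).
  by rewrite -addrA -(lZ h (v c)) -lD.
rewrite /u lE -subr_gt0.
have : K * d (h *: v c + c) <= K * (d c + h * e) by rewrite ler_pM2l.
have -> : K * (d c + h * e) = K * d c + h * l (v c) / 2.
  by rewrite mulrDr /e; congr (_ + _); field; rewrite gt_eqF.
have : 0 < h * l (v c) by rewrite mulr_gt0.
move: (d _) (d c) (l _) (h * l _) => x y z t; lra.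
Qed.

End Kernel_directions.

Lemma continuous_pair_cst (R : realType) (E F : normedModType R) (b : F) :
  continuous (fun a : E => (a, b)).
Proof. by move=> a; apply: cvg_pair; [exact: cvg_id|exact: cvg_cst]. Qed.

(** * Group laws, orbit maps and left translates *)

Section Lie_group_actions.
Local Set Implicit Arguments.
Local Unset Strict Implicit.
Context {R : realType} {k n : nat} {G : lie_group R k} {M : smooth_manifold R n}.
Variable Phi : G -> M -> M.
Hypotheses (Phi_action : left_action Phi) (Phi_smooth : smooth_action Phi).

Local Notation e := (lie_one G).
Local Notation mul := (@lie_mul R k G).
Local Notation inv := (@lie_inv R k G).

Let mul_smooth : smooth_map (M := prod_space G G) (N := G) (fun p => mul p.1 p.2)
  := lie_mul_smooth G.

Lemma lie_mulgV (g : G) : mul g (inv g) = e.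
Proof.
rewrite -[LHS]lie_mul1g -{1}(lie_mulVg (inv g)) -lie_mulA.
by rewrite [mul (inv g) _]lie_mulA lie_mulVg lie_mul1g lie_mulVg.
Qed.

Lemma lie_mulg1 (g : G) : mul g e = g.
Proof. by rewrite -(lie_mulVg g) lie_mulA lie_mulgV lie_mul1g. Qed.

Lemma act1 x : Phi e x = x. Proof. by have [] := Phi_action. Qed.

Lemma actM g h x : Phi (mul g h) x = Phi g (Phi h x).
Proof. by have [_] := Phi_action. Qed.

Lemma actK g x : Phi (inv g) (Phi g x) = x.
Proof. by rewrite -actM lie_mulVg act1. Qed.

Lemma actKV g x : Phi g (Phi (inv g) x) = x.
Proof. by rewrite -actM lie_mulgV act1. Qed.

Lemma continuous_orbit x : continuous (Phi^~ x).
Proof.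
exact: (continuous_partial_l (M := G) (N := M) (P := M) (f := Phi) Phi_smooth).
Qed.

Lemma continuous_act g : continuous (Phi g).
Proof.
exact: (continuous_partial_r (M := G) (N := M) (P := M) (f := Phi) Phi_smooth).
Qed.

Lemma continuous_mulg (g : G) : continuous (mul g).
Proof.
exact: (continuous_partial_r (M := G) (N := G) (P := G) (f := mul) mul_smooth).
Qed.

(** [tangent_map] uses the chart at [Phi e x]; here the target chart is the one at [x], as the chain
    rule in charts requires. *)
Lemma infinitesimal_generatorE xi x :
  infinitesimal_generator Phi xi x =
  'd (local_expr e x (Phi^~ x)) (chart_at e e) xi.
Proof. by rewrite /infinitesimal_generator /tangent_map act1. Qed.

Lemma local_expr_orbit_diff g x : chart_dom (chart_at e) g ->
  chart_dom (chart_at x) (Phi g x) ->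
  differentiable (local_expr e x (Phi^~ x)) (chart_at e g).
Proof.
move=> eg xgx.
by have [] := local_expr_partial_l (M := G) (N := M) (P := M) (f := Phi)
  Phi_smooth (act1 x) eg (chart_at_dom x) xgx.
Qed.

Lemma generator_eq0 (Phi_free : free_action Phi) xi x :
  infinitesimal_generator Phi xi x = 0 -> xi = 0.
Proof.
rewrite infinitesimal_generatorE => gen0.
have de := chart_at_dom e; have dx := chart_at_dom x.
set a0 := chart_at e e in gen0.
pose f := local_expr e x (Phi^~ x).
(* The left-invariant field of [xi] in the chart at [e]: at the coordinates of [g], the derivative
   of [h |-> mul g h] at [e]. Its continuity comes from the joint smoothness of [mul]. *)
pose v (a : 'rV[R]_k) : 'rV[R]_k :=
  'D_(0, xi) (prod_expr (P := G) mul e e e) (a, a0).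
have ee := lie_mul1g e.
have vE g : chart_dom (chart_at e) g ->
    v (chart_at e g) = 'd (local_expr e e (mul g)) a0 xi.
  move=> eg; rewrite /v.
  have [|_ ->//] := local_expr_partial_r (M := G) (N := G) (P := G)
    (f := mul) mul_smooth ee eg de.
  by rewrite lie_mulg1.
have va0 : v a0 = xi.
  rewrite vE // (_ : mul e = id); last by apply/funext => h; rewrite lie_mul1g.
  by rewrite local_expr_id_same.
have near_e (P : 'rV[R]_k -> Prop) : (forall g, chart_dom (chart_at e) g ->
    chart_dom (chart_at x) (Phi g x) -> P (chart_at e g)) -> \forall a \near a0, P a.
  move=> HP.
  have nx : \forall g \near e, chart_dom (chart_at x) (Phi g x).
    apply: continuous_orbit; rewrite /= act1; exact: near_chart_dom.
  apply: filterS (near_chart_inv de nx) => a [ca xa].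
  by rewrite -(chart_invK ca); apply: HP => //; exact: chart_invP.
rewrite -va0; apply: (kernel_directions_not_injective (f := f) (a0 := a0)).
- apply: near_e => g eg xg; apply: differentiable_continuous.
  exact: local_expr_orbit_diff.
(* Differentiate [Phi (mul g h) x = Phi g (Phi h x)] in [h] at [e]: on the right, the inner
   differential kills [xi] by [gen0]. *)
- apply: near_e => g eg xg; split; first exact: local_expr_orbit_diff.
  rewrite vE //.
  have xe : chart_dom (chart_at x) (Phi e x) by rewrite act1.
  have [d1 _] := local_expr_partial_r (M := G) (N := G) (P := G)
    (f := mul) (y' := e) mul_smooth ee eg de ltac:(by rewrite lie_mulg1).
  have [d2 _] := local_expr_partial_r (M := G) (N := M) (P := M)
    (f := Phi) Phi_smooth (act1 x) eg dx xg.
  have [_ E1] := local_expr_comp (f := mul g) (g := Phi^~ x) (a := e) (x := e)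
    (b := e) (c := x) de ltac:(by rewrite lie_mulg1) (@continuous_mulg g e) d1
    ltac:(by rewrite lie_mulg1; exact: local_expr_orbit_diff).
  have [_ E2] := local_expr_comp (f := Phi^~ x) (g := Phi g) (a := e) (x := e)
    (b := x) (c := x) de xe (@continuous_orbit x e)
    (local_expr_orbit_diff de xe) ltac:(by rewrite /= act1).
  have E3 : (fun h => Phi (mul g h) x) = (fun h => Phi g (Phi h x)).
    by apply/funext => h; rewrite actM.
  have E4 := etrans (E2 xi) (etrans (congr1 _ gen0) (linear0 _)).
  rewrite -E3 in E4.
  have := E1 xi; rewrite lie_mulg1 => E5.
  exact: etrans (esym E5) E4.
(* Equal values in the chart at [x] mean [Phi g x = x], whence [g = e] by freeness. *)
- apply: near_e => g eg xg.
  rewrite /f /local_expr !chart_funK // act1 => /(congr1 (chart_inv (chart_at x))).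
  by rewrite !chart_funK // => /Phi_free ->.
- have [_ /(_ (0, xi)) /(_ (a0, a0))] := prod_expr_smooth mul_smooth ee 1%N.
  have he : chart_dom (chart_at e) (mul e e) by rewrite ee.
  move=> /(_ (prod_expr_dom_chart de de he)) /= c.
  exact: (continuous_comp (@continuous_pair_cst R 'rV[R]_k 'rV[R]_k a0 a0) c).
Qed.

End Lie_group_actions.

(** * Invariance of the horizontal distribution *)

Section Cotangent_vectors.
Local Set Implicit Arguments.
Local Unset Strict Implicit.
Context {R : realType} {n : nat} {M : smooth_manifold R n}.
Implicit Types x c : M.

Lemma pairing_inj x (alpha beta : cotangent x) :
  (forall v, pairing alpha v = pairing beta v) -> alpha = beta.
Proof.
move=> ab; apply/colP => i; have := ab (delta_mx 0 i).
by rewrite /pairing -!rowE !mxE.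
Qed.

Lemma pairing_vector_inj x (u v : tangent x) :
  (forall beta, pairing beta u = pairing beta v) -> u = v.
Proof.
move=> uv; apply/rowP => i; have := uv (delta_mx i 0).
by rewrite /pairing -!colE !mxE.
Qed.

Lemma pairingDZ x (alpha beta : cotangent x) (t : R) (v : tangent x) :
  pairing (alpha + t *: beta) v = pairing alpha v + t * pairing beta v.
Proof. by rewrite /pairing mulmxDr -scalemxAr !mxE. Qed.

Lemma pairing_cotangent_of_coord c x (p : 'cV[R]_n) (v : tangent x) :
  pairing (cotangent_of_coord c x p) v = (tangent_coord c x v *m p) 0 0.
Proof.
rewrite /cotangent_of_coord; set l := fun _ => _.
have ll : linear (l : 'rV[R]_n -> R^o).
  by move=> a u w; rewrite /l /tangent_coord linearP mulmxDl -scalemxAl !mxE.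
pose L := GRing.isLinear.Build R 'rV[R]_n R^o *:%R l ll.
exact: (pairing_covector (HB.pack_for {linear 'rV[R]_n -> R^o} l L) v).
Qed.

Lemma cotangent_of_coordDZ c x (p q : 'cV[R]_n) (t : R) :
  cotangent_of_coord c x (p + t *: q) =
  (cotangent_of_coord c x p : 'cV[R]_n) + t *: cotangent_of_coord c x q.
Proof.
apply: (@pairing_inj x) => v; rewrite pairingDZ !pairing_cotangent_of_coord.
by rewrite mulmxDr -scalemxAr !mxE.
Qed.

Lemma tangent_coord_id x (v : tangent x) : tangent_coord x x v = v.
Proof. by rewrite /tangent_coord local_expr_id_same //; exact: chart_at_dom. Qed.

Lemma cotangent_of_coord_id x (p : 'cV[R]_n) : cotangent_of_coord x x p = p.
Proof.
apply: pairing_inj => v.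
by rewrite pairing_cotangent_of_coord tangent_coord_id.
Qed.

Lemma tangent_coordK c x : chart_dom (chart_at c) x ->
  exists2 f : 'rV[R]_n -> tangent x,
    cancel (@tangent_coord _ _ M c x) f & cancel f (@tangent_coord _ _ M c x).
Proof.
move=> cx; have dx := chart_at_dom x.
have d1 := local_expr_id_diff dx cx; have d2 := local_expr_id_diff cx dx.
exists ('d (local_expr c x (@id M)) (chart_at c x)) => v.
  have [_ /(_ v) E] := local_expr_comp (f := @id M) (g := @id M) dx cx
    (@continuous_at_id _ x) d1 d2.
  exact: etrans (esym E) (local_expr_id_same v dx).
have [_ /(_ v) E] := local_expr_comp (f := @id M) (g := @id M) cx dx
  (@continuous_at_id _ x) d2 d1.
exact: etrans (esym E) (local_expr_id_same v cx).
Qed.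

(** In the bundle chart centered at [x], coordinates on the fiber over [x] are the covectors
    themselves, so [H x] is a restriction of the chart expression of [H]. *)
Lemma hamiltonian_differentiable (H : forall x, cotangent x -> R) x
    (alpha : cotangent x) : smooth_hamiltonian H -> differentiable (H x) alpha.
Proof.
move=> /(_ x 1%N) [/= + _] => /(_ (chart_at x x, alpha)).
have dx := chart_at_dom x.
move=> /(_ (conj (chart_funP dx) I)) dH.
have -> : H x = (fun q : 'rV[R]_n * 'cV[R]_n =>
    H (chart_inv (chart_at x) q.1)
      (cotangent_of_coord x (chart_inv (chart_at x) q.1) q.2)) \o
    (fun p => (chart_at x x, p)).
  by apply/funext => p /=; rewrite chart_funK // cotangent_of_coord_id.
exact: differentiable_comp.
Qed.

End Cotangent_vectors.

Section Invariance.
Local Set Implicit Arguments.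
Local Unset Strict Implicit.
Context {R : realType} {k n : nat} {G : lie_group R k} {M : smooth_manifold R n}.
Variable Phi : G -> M -> M.
Hypotheses (Phi_action : left_action Phi) (Phi_smooth : smooth_action Phi).

Local Notation e := (lie_one G).
Local Notation mul := (@lie_mul R k G).
Local Notation inv := (@lie_inv R k G).

Let mul_smooth : smooth_map (M := prod_space G G) (N := G) (fun p => mul p.1 p.2)
  := lie_mul_smooth G.

Lemma local_expr_act_diff g x y : Phi g x = y ->
  differentiable (local_expr x y (Phi g)) (chart_at x x).
Proof.
move=> gxy.
have yx : chart_dom (chart_at y) (Phi g x) by rewrite gxy; exact: chart_at_dom.
by have [] := local_expr_partial_r (M := G) (N := M) (P := M) (f := Phi)
  Phi_smooth gxy (chart_at_dom g) (chart_at_dom x) yx.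
Qed.

Lemma local_expr_actK g h x y v : Phi g x = y -> Phi h y = x ->
  (forall z, Phi h (Phi g z) = z) ->
  'd (local_expr y x (Phi h)) (chart_at y y)
    ('d (local_expr x y (Phi g)) (chart_at x x) v) = v.
Proof.
move=> gxy hyx hg.
have yx : chart_dom (chart_at y) (Phi g x) by rewrite gxy; exact: chart_at_dom.
have d2 : differentiable (local_expr y x (Phi h)) (chart_at y (Phi g x)).
  by rewrite gxy; exact: local_expr_act_diff.
have [_ /(_ v)] := local_expr_comp (chart_at_dom x) yx
  (continuous_act Phi_smooth (x := x)) (local_expr_act_diff gxy) d2.
rewrite gxy => <-.
rewrite (_ : (fun z => _) = id) ?local_expr_id_same //; first exact: chart_at_dom.
exact/funext.
Qed.

Lemma pairing_cotangent_lift g x (alpha : cotangent x)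
    (v : tangent (Phi g x)) :
  pairing (cotangent_lift Phi g x alpha) v =
  pairing alpha ('d (local_expr (Phi g x) x (Phi (inv g)))
    (chart_at (Phi g x) (Phi g x)) v : tangent x).
Proof. by rewrite cotangent_liftP /tangent_map actK. Qed.

Lemma cotangent_liftDZ g x (alpha beta : cotangent x) (t : R) :
  cotangent_lift Phi g x (alpha + t *: beta) =
  cotangent_lift Phi g x alpha + t *: cotangent_lift Phi g x beta.
Proof.
by apply: pairing_inj => v; rewrite pairingDZ !pairing_cotangent_lift pairingDZ.
Qed.

(** [zeta] is the image of [xi] under the adjoint action of [inv g]: differentiate [Phi (inv g) (Phi
    h (Phi g x)) = Phi (conj h) x] in [h] at [e], where [conj] is conjugation by [inv g]. *)
Lemma generator_conj g x xi : exists zeta,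
  'd (local_expr (Phi g x) x (Phi (inv g))) (chart_at (Phi g x) (Phi g x))
    (infinitesimal_generator Phi xi (Phi g x)) =
  infinitesimal_generator Phi zeta x.
Proof.
have de := chart_at_dom e.
set g' := inv g; set y := Phi g x.
pose conj (h : G) : G := mul (mul g' h) g.
have conj_e : conj e = e by rewrite /conj lie_mulg1 lie_mulVg.
have g'e := lie_mulg1 g'; have g'g : mul g' g = e := lie_mulVg g.
have dg' : chart_dom (chart_at g') (mul g' e) by rewrite g'e; exact: chart_at_dom.
have dg'g : chart_dom (chart_at e) (mul g' g) by rewrite g'g.
(* Conjugation is a left translation from [e] to [g'] followed by a right translation from [g'] back
   to [e], each read in the charts at these points. *)
have [d1 _] := local_expr_partial_r (M := G) (N := G) (P := G) (f := mul)
  mul_smooth g'e (chart_at_dom g') de dg'.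
have [d2 _] := local_expr_partial_l (M := G) (N := G) (P := G) (f := mul)
  mul_smooth g'g (chart_at_dom g') (chart_at_dom g) dg'g.
have d2' : differentiable (local_expr g' e (mul^~ g)) (chart_at g' (mul g' e)).
  by rewrite g'e.
have [dconj _] := local_expr_comp de dg' (continuous_mulg (g := g') (x := e)) d1 d2'.
exists ('d (local_expr e e conj) (chart_at e e) xi).
rewrite !infinitesimal_generatorE //.
have ye : chart_dom (chart_at y) (Phi e y) by rewrite act1 //; exact: chart_at_dom.
have d3 : differentiable (local_expr y x (Phi g')) (chart_at y (Phi e y)).
  by rewrite act1 //; apply: local_expr_act_diff; exact: actK.
have [_ E1] := local_expr_comp de ye (continuous_orbit Phi_smooth (x := y) (x0 := e))
  (local_expr_orbit_diff Phi_action Phi_smooth de ye) d3.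
have dce : chart_dom (chart_at e) (conj e) by rewrite conj_e.
have cconj : {for e, continuous conj}.
  apply: (continuous_comp (f := mul g') (g := mul^~ g)).
    exact: continuous_mulg.
  exact: (continuous_partial_l (M := G) (N := G) (P := G) (f := mul) mul_smooth).
have xe : chart_dom (chart_at x) (Phi e x) by rewrite act1 //; exact: chart_at_dom.
have d4 : differentiable (local_expr e x (Phi^~ x)) (chart_at e (conj e)).
  by rewrite conj_e; exact: local_expr_orbit_diff.
have [_ E2] := local_expr_comp de dce cconj dconj d4.
have E3 : (fun h => Phi g' (Phi h y)) = (fun h => Phi (conj h) x).
  by apply/funext => h; rewrite /conj !actM.
have E4 := E1 xi; rewrite E3 in E4.
have E5 := etrans (esym E4) (E2 xi).
by rewrite conj_e act1 // in E5.
Qed.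

Lemma zero_momentum_lift g x (alpha : cotangent x) :
  zero_momentum Phi x alpha ->
  zero_momentum Phi (Phi g x) (cotangent_lift Phi g x alpha).
Proof.
move=> a0 xi; rewrite /momentum_map pairing_cotangent_lift.
by have [zeta ->] := generator_conj g x xi; exact: a0.
Qed.

Lemma invariant_horizontal (H : forall x : M, cotangent x -> R) :
  smooth_hamiltonian H -> invariant_hamiltonian Phi H ->
  invariant_distribution Phi (horizontal Phi H).
Proof.
move=> H_smooth H_inv.
(* With [y] a variable, the claim also applies to [inv g], which maps [Phi g x] to [x] only by the
   action law; this gives the reverse inclusion. *)
have sub g x y v : Phi g x = y -> horizontal Phi H x v ->
    horizontal Phi H y ('d (local_expr x y (Phi g)) (chart_at x x) v).
  move=> gxy; rewrite -{y}gxy => -[alpha a0 <-].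
  exists (cotangent_lift Phi g x alpha); first exact: zero_momentum_lift.
  set w := fiber_derivative _ _ _.
  (* Equivariance of FH, tested against [beta]: by invariance, [H] takes the same values along
     [alpha + t *: beta] and along its cotangent lift. *)
  have <- : 'd (local_expr (Phi g x) x (Phi (inv g)))
      (chart_at (Phi g x) (Phi g x)) w = fiber_derivative H x alpha.
    apply: (@pairing_vector_inj _ _ _ x) => beta.
    rewrite -pairing_cotangent_lift /w.
    rewrite !fiber_derivativeP; last 2 first.
    - exact: hamiltonian_differentiable.
    - exact: hamiltonian_differentiable.
    by congr derive1; apply/funext => t; rewrite -cotangent_liftDZ H_inv.
  by rewrite local_expr_actK // => [|z]; [exact: actK|exact: actKV].
move=> g x; apply/seteqP; split => [_ [v hv <-]|v hv]; first exact: sub.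
have := sub (inv g) (Phi g x) x v (actK Phi_action g x) hv.
move=> hx; exists ('d (local_expr (Phi g x) x (Phi (inv g)))
  (chart_at (Phi g x) (Phi g x)) v) => //.
rewrite /tangent_map local_expr_actK // => [|z]; [exact: actK|exact: actKV].
Qed.

End Invariance.

(** * Generators are vertical *)

Section Curves_in_orbits.
Local Set Implicit Arguments.
Local Unset Strict Implicit.
Context {R : realType}.

(** Allows the intermediate charts used for a curve to change from one time to another. *)
Lemma Ck_on_local (E F : normedModType R) k (A : set E) (f : E -> F) :
  (forall x, A x -> exists B, [/\ open B, B x & Ck_on k B f]) -> Ck_on k A f.
Proof.
elim: k f => [|k IH] f AB /=.
  by move=> x /AB[B [_ Bx /(_ x Bx)]].
split=> [x /AB[B [_ Bx [/(_ x Bx)]]] //|v].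
by apply: IH => x /AB[B [oB Bx [_ /(_ v)]]]; exists B.
Qed.

Lemma continuous_line (E : normedModType R) (a v : E) :
  continuous (fun t : R => a + t *: v).
Proof.
move=> t; apply: cvgD; first exact: cvg_cst.
by apply: cvgZ; [exact: cvg_id|exact: cvg_cst].
Qed.

Lemma Ck_on_line (E : normedModType R) k (A : set R) (a v : E) : open A ->
  Ck_on k A (fun t : R => a + t *: v).
Proof.
move=> oA; apply: Ck_on_add => //; first exact: Ck_on_cst.
by apply: Ck_on_scale => //; [exact: Ck_on_id|exact: Ck_on_cst].
Qed.

Lemma line_diff (E : normedModType R) (a v : E) (t : R) :
  differentiable (fun t : R => a + t *: v) t /\
  'd (fun t : R => a + t *: v) t 1 = v.
Proof.
have D : is_diff t (cst a + *:%R^~ v : R -> E) (0 + *:%R^~ v).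
  exact: is_diffD.
have -> : (fun t : R => a + t *: v) = cst a + *:%R^~ v by [].
by split; [exact: ex_diff|rewrite diff_val /= add0r scale1r].
Qed.

Context {k n : nat} {G : lie_group R k} {M : smooth_manifold R n}.
Variable Phi : G -> M -> M.
Hypotheses (Phi_action : left_action Phi) (Phi_smooth : smooth_action Phi).

Local Notation e := (lie_one G).

Lemma open_line_preimage (E : normedModType R) (a v : E) (A : set E) :
  open A -> open [set t : R | A (a + t *: v)].
Proof.
move=> oA; apply: (@open_comp _ _ (fun t : R => a + t *: v)) => // t _.
exact: continuous_line.
Qed.

(** A straight line in the chart at [e] replaces the one-parameter subgroup: it has the velocity
    [xi] at [e], and its image under the orbit map stays in the orbit. *)
Lemma generator_vertical xi x :
  vertical Phi x (infinitesimal_generator Phi xi x).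
Proof.
have de := chart_at_dom e; have dx := chart_at_dom x.
set a0 := chart_at e e.
pose l (t : R) : 'rV[R]_k := a0 + t *: (xi : 'rV[R]_k).
pose g t : G := chart_inv (chart_at e) (l t).
pose c (t : R) : M := Phi (g t) x.
pose U := [set t | chart_cod (chart_at e) (l t)].
have l0 : l 0 = a0 by rewrite /l scale0r addr0.
have g0 : g 0 = e by rewrite /g l0 chart_funK.
have c0 : c 0 = x by rewrite /c g0 act1.
have lc : continuous l by exact: (@continuous_line 'rV[R]_k).
have oU : open U by apply: (@open_line_preimage 'rV[R]_k); exact: chart_open_cod.
have gc t : U t -> {for t, continuous g}.
  by move=> Ut; apply: (continuous_comp (lc t)); exact: chart_inv_continuous.
have cc t : U t -> {for t, continuous c}.
  move=> /gc h.
  exact: (continuous_comp h (continuous_orbit Phi_smooth (x := x) (x0 := g t))).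
have open_g (V : set G) : open V -> open [set t | U t /\ V (g t)].
  by move=> oV; exact: (@open_map_preimage R R _ (model_space R) G g U V).
have open_c (V : set M) : open V -> open [set t | U t /\ V (c t)].
  by move=> oV; exact: (@open_map_preimage R R _ (model_space R) M c U V).
exists U, c; split => //.
- by rewrite /U /= l0; exact: chart_funP.
- split=> [t Ut|t Ut m]; first exact: cc.
  apply: Ck_on_local => s /= [_ [Us ds]].
  (* Near [(g s, x)], the action is known to be smooth in the charts at [g s], [x] and [y1]. On [B]
     one passes from the chart at [e] to that at [g s], applies the action, then passes from the
     chart at [y1] to that at [c t]. *)
  pose y1 := c s.
  pose B := [set s' | U s' /\ chart_dom (chart_at (g s)) (g s')] `&`
    ([set s' | U s' /\ chart_dom (chart_at y1) (c s')] `&`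
     [set s' | U s' /\ chart_dom (chart_at (c t)) (c s')]).
  have oB : open B.
    apply: openI; first by apply: open_g; exact: chart_open_dom.
    by apply: openI; apply: open_c; exact: chart_open_dom.
  have dg := chart_at_dom (g s); have dy := chart_at_dom y1.
  exists B; split => //.
  pose TG : set 'rV[R]_k := [set b | chart_cod (chart_at e) b /\
    chart_dom (chart_at (g s)) (chart_inv (chart_at e) b)].
  pose TM : set 'rV[R]_n := [set b | chart_cod (chart_at y1) b /\
    chart_dom (chart_at (c t)) (chart_inv (chart_at y1) b)].
  have oTG : open TG by apply: open_chart_preimage; exact: chart_open_dom.
  have oTM : open TM by apply: open_chart_preimage; exact: chart_open_dom.
  have Cl : Ck_on m B l by exact: (@Ck_on_line 'rV[R]_k).
  have Cg : Ck_on m B (fun s' => chart_at (g s) (g s')).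
    apply: (Ck_on_comp (@finite_coordinates_mx R 1 k) oB oTG _ Cl
      (manifold_compatible e (g s) m)).
    by move=> s' [[? ?] _]; split.
  have Cp : Ck_on m B (fun s' => (chart_at (g s) (g s'), chart_at x x)).
    by apply: Ck_on_pair => //; exact: Ck_on_cst.
  have oP := open_prod_expr_dom (M := G) (N := M) (P := M) (f := Phi)
    Phi_smooth (x := g s) (y := x) (z := y1).
  have Cy : Ck_on m B (fun s' => chart_at y1 (c s')).
    have CP : Ck_on m (prod_expr_dom (P := M) Phi (g s) x y1)
        (prod_expr (P := M) Phi (g s) x y1).
      exact: (prod_expr_smooth (M := G) (N := M) (P := M) (f := Phi) Phi_smooth).
    have fc := finite_coordinates_prod (@finite_coordinates_mx R 1 k)
      (@finite_coordinates_mx R 1 n).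
    have hB s' : B s' -> prod_expr_dom (P := M) Phi (g s) x y1
        (chart_at (g s) (g s'), chart_at x x).
      by move=> [[? ?] [[? ?] _]]; exact: prod_expr_dom_chart.
    apply: eq_Ck_on (Ck_on_comp fc oB oP hB Cp CP) => // s' [[? ?] _].
    by rewrite /prod_expr /= !chart_funK.
  have hB s' : B s' -> TM (chart_at y1 (c s')).
    move=> [_ [[? ?] [_ ?]]]; split; first exact: chart_funP.
    by rewrite /= chart_funK.
  apply: eq_Ck_on (Ck_on_comp (@finite_coordinates_mx R 1 n) oB oTM hB Cy
    (manifold_compatible y1 (c t) m)) => // s' [_ [[? ?] _]].
  by rewrite /local_expr /= chart_funK.
- by move=> t _; exists (g t).
- split=> //; rewrite infinitesimal_generatorE // /tangent_map c0.
  have xe : chart_dom (chart_at x) (Phi e x) by rewrite act1.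
  have d1 := local_expr_orbit_diff Phi_action Phi_smooth de xe.
  rewrite -/a0 -l0 in d1 *.
  have [d2 e2] := @line_diff 'rV[R]_k a0 xi 0.
  have e3 := diff_comp d2 d1.
  have e4 := congr1 (fun F : R -> 'rV[R]_n => F 1) e3.
  exact: etrans e4 (congr1 _ e2).
Qed.

End Curves_in_orbits.

(** * Rank and smoothness of the horizontal distribution *)

Section Horizontal_distribution.
Local Set Implicit Arguments.
Local Unset Strict Implicit.
Context {R : realType} {k n : nat} {G : lie_group R k} {M : smooth_manifold R n}.
Variables (Phi : G -> M -> M) (H : forall x : M, cotangent x -> R).
Hypotheses (Phi_action : left_action Phi) (Phi_smooth : smooth_action Phi).
Hypothesis Phi_free : free_action Phi.
Hypothesis H_smooth : smooth_hamiltonian H.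
Hypothesis FH_linear : forall x : M, linear (fiber_derivative H x).
Hypothesis FH_nondegenerate : forall (x : M) (alpha beta : cotangent x),
  zero_momentum Phi x alpha -> zero_momentum Phi x beta ->
  fiber_derivative H x alpha = fiber_derivative H x beta -> alpha = beta.

Local Notation e := (lie_one G).

Definition generator_mx (x : M) : 'M[R]_(k, n) :=
  \matrix_i (infinitesimal_generator Phi (delta_mx 0 i) x : 'rV[R]_n).

Definition fiber_derivative_mx (x : M) : 'M[R]_n :=
  \matrix_i (fiber_derivative H x (delta_mx i 0) : 'rV[R]_n).

(** Acting on rows from the right, it takes vectors at [x] to the chart at [c]; acting on columns
    from the left, it brings covector coordinates back from that chart. *)
Definition transition_mx (c x : M) : 'M[R]_n :=
  \matrix_i (tangent_coord c x (delta_mx 0 i) : 'rV[R]_n).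

Lemma mulmx_rows m p (f : 'rV[R]_m -> 'rV[R]_p) (v : 'rV[R]_m) :
  linear f -> v *m \matrix_i f (delta_mx 0 i) = f v.
Proof.
move=> fl; pose L := GRing.isLinear.Build _ _ _ _ f fl.
pose F : {linear 'rV[R]_m -> 'rV[R]_p} := HB.pack f L.
rewrite mulmx_sum_row [in RHS](row_sum_delta v) -[f]/(F : _ -> _) linear_sum.
by apply: eq_bigr => i _; rewrite rowK linearZ.
Qed.

Lemma generator_mxE x xi :
  infinitesimal_generator Phi xi x = (xi : 'rV[R]_k) *m generator_mx x.
Proof.
rewrite (mulmx_rows (f := fun xi => infinitesimal_generator Phi xi x)) //.
by move=> a u v; rewrite !infinitesimal_generatorE // linearP.
Qed.

Lemma tangent_coordE c x v :
  tangent_coord c x v = (v : 'rV[R]_n) *m transition_mx c x.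
Proof.
rewrite (mulmx_rows (f := fun v : 'rV[R]_n => tangent_coord c x v)) //.
by move=> a u w; rewrite /tangent_coord linearP.
Qed.

Lemma fiber_derivativeE x (alpha : cotangent x) :
  fiber_derivative H x alpha = (alpha : 'cV[R]_n)^T *m fiber_derivative_mx x.
Proof.
have -> : fiber_derivative_mx x =
    \matrix_i fiber_derivative H x ((delta_mx 0 i : 'rV[R]_n)^T).
  by apply/matrixP => i j; rewrite !mxE trmx_delta.
rewrite (mulmx_rows (f := fun u : 'rV[R]_n => fiber_derivative H x u^T)).
  by rewrite trmxK.
by move=> a u v; rewrite linearP; exact: FH_linear.
Qed.

Lemma cotangent_of_coordE c x p :
  cotangent_of_coord c x p = transition_mx c x *m p.
Proof.
apply: (@pairing_inj _ _ _ x) => v; rewrite pairing_cotangent_of_coord.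
by rewrite tangent_coordE /pairing mulmxA.
Qed.

Lemma transition_mx_unit c x : chart_dom (chart_at c) x ->
  transition_mx c x \in unitmx.
Proof.
move=> cx; rewrite -row_free_unit; apply: inj_row_free => v vT0.
have [f fK _] := tangent_coordK cx.
by rewrite -[v]fK -[RHS]fK !tangent_coordE vT0 mul0mx.
Qed.

Lemma zero_momentumP x (alpha : cotangent x) :
  zero_momentum Phi x alpha <-> generator_mx x *m (alpha : 'cV[R]_n) = 0.
Proof.
have E xi : momentum_map Phi x alpha xi =
    ((xi : 'rV[R]_k) *m (generator_mx x *m (alpha : 'cV[R]_n))) 0 0.
  by rewrite /momentum_map /pairing generator_mxE mulmxA.
split=> [a0|a0 xi]; last by rewrite E a0 mulmx0 mxE.
apply/colP => i; have := a0 (delta_mx 0 i).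
by rewrite E -rowE !mxE.
Qed.

Lemma generator_mx_free x : row_free (generator_mx x).
Proof.
apply: inj_row_free => xi; rewrite -generator_mxE.
exact: generator_eq0.
Qed.

Lemma horizontalP x (v : tangent x) : horizontal Phi H x v <->
  ((v : 'rV[R]_n) <= kermx (generator_mx x)^T *m fiber_derivative_mx x)%MS.
Proof.
split=> [[alpha /zero_momentumP a0 <-]|/submxP[w ->]].
  rewrite fiber_derivativeE submxMr //; apply/sub_kermxP.
  by rewrite -trmx_mul a0 trmx0.
exists (w *m kermx (generator_mx x)^T)^T.
  apply/zero_momentumP; rewrite -[X in X *m _]trmxK -trmx_mul -mulmxA.
  by rewrite mulmx_ker mulmx0 trmx0.
by rewrite fiber_derivativeE trmxK mulmxA.
Qed.

(** Injectivity of FH on the zero momentum covectors means that the two kernels meet in 0, so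
    multiplying by the matrix of FH keeps the rank, which is [n - k] because the generators are
    independent. *)
Lemma horizontal_rank x :
  \rank (kermx (generator_mx x)^T *m fiber_derivative_mx x) = (n - k)%N.
Proof.
set N := kermx _; set L := fiber_derivative_mx x.
have NL : (N :&: kermx L)%MS = 0.
  apply/eqP; rewrite -submx0; apply/row_subP => i.
  set u := row i _.
  have : (u <= N :&: kermx L)%MS by exact: row_sub.
  rewrite sub_capmx => /andP[/sub_kermxP uA /sub_kermxP uL].
  have : u^T = 0.
    apply: (FH_nondegenerate (x := x)).
    - by apply/zero_momentumP; rewrite -[generator_mx x]trmxK -trmx_mul uA trmx0.
    - by apply/zero_momentumP; rewrite mulmx0.
    - by rewrite !fiber_derivativeE trmxK uL trmx0 mul0mx.
  by move/(congr1 trmx); rewrite trmxK trmx0 => ->; exact: sub0mx.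
have := mxrank_mul_ker N L; rewrite NL mxrank0 addn0 => ->.
by rewrite mxrank_ker mxrank_tr (eqP (generator_mx_free x)).
Qed.

Lemma horizontal_vertical_sum x :
  horizontal Phi H x `&` vertical Phi x = [set 0] ->
  direct_sum (horizontal Phi H x) (vertical Phi x).
Proof.
move=> hv; split=> // v.
set A := generator_mx x; set D := kermx A^T *m fiber_derivative_mx x.
have vA xi : vertical Phi x ((xi : 'rV[R]_k) *m A).
  by rewrite -generator_mxE; exact: generator_vertical.
have DA : (D :&: A)%MS = 0.
  apply/eqP; rewrite -submx0; apply/row_subP => i.
  have := row_sub i (D :&: A)%MS.
  rewrite sub_capmx => /andP[uD /submxP[w uA]].
  have : (horizontal Phi H x `&` vertical Phi x) (row i (D :&: A)%MS).
    by split; [exact/horizontalP|rewrite uA].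
  by rewrite hv => ->; exact: sub0mx.
(* Subtraction is truncated: this is what makes the ranks [n - k] and [k] add up to [n]. *)
have kn : (k <= n)%N by rewrite -(eqP (generator_mx_free x)) rank_leq_col.
have full : (1%:M <= D + A)%MS.
  rewrite sub1mx /row_full; have := mxrank_sum_cap D A.
  rewrite DA mxrank0 addn0 => ->.
  by rewrite horizontal_rank (eqP (generator_mx_free x)) subnK.
have /sub_addsmxP[[u w] /= vE] : ((v : 'rV[R]_n) <= D + A)%MS.
  by apply: submx_trans full; rewrite submx1.
exists (u *m D), (w *m A); split=> //.
by apply/horizontalP; exact: submxMl.
Qed.

(** * Generators and fiber derivative in a fixed chart *)

Section Local_frame.
Variable c : M.

Definition generator_coord (y : 'rV[R]_n) : 'M[R]_(k, n) :=
  \matrix_i ('D_(delta_mx 0 i, 0) (prod_expr (M := G) (N := M) (P := M) Phi e c c)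
    (chart_at e e, y) : 'rV[R]_n).

Definition hamiltonian_coord (q : 'rV[R]_n * 'cV[R]_n) : R :=
  H (cotangent_of_coord c (chart_inv (chart_at c) q.1) q.2).

(** FH being linear on fibers, its values at the basis covectors suffice: row [i] is the image of
    the [i]-th one, its [j]-th coordinate being a derivative of [H] along the [j]-th one. *)
Definition fiber_derivative_coord (y : 'rV[R]_n) : 'M[R]_n :=
  \matrix_(i, j) 'D_(0, delta_mx j 0) hamiltonian_coord (y, delta_mx i 0).

Lemma generator_coordE x : chart_dom (chart_at c) x ->
  generator_coord (chart_at c x) = generator_mx x *m transition_mx c x.
Proof.
move=> cx; apply/row_matrixP => i; rewrite row_mul !rowK -tangent_coordE.
have de := chart_at_dom e; have dx := chart_at_dom x.
have ce : chart_dom (chart_at c) (Phi e x) by rewrite act1.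
have xe : chart_dom (chart_at x) (Phi e x) by rewrite act1.
have [_ E1] := local_expr_partial_l (M := G) (N := M) (P := M) (f := Phi)
  Phi_smooth (act1 Phi_action c) de cx ce.
have d1 := local_expr_orbit_diff Phi_action Phi_smooth de xe.
have d2 : differentiable (local_expr x c (@id M)) (chart_at x (Phi e x)).
  by rewrite act1 //; exact: local_expr_id_diff.
have [_ E2] := local_expr_comp (g := @id M) de xe
  (continuous_orbit Phi_smooth (x := x) (x0 := e)) d1 d2.
rewrite infinitesimal_generatorE // /tangent_coord.
have E3 := etrans (esym (E1 (delta_mx 0 i))) (E2 (delta_mx 0 i)).
by rewrite act1 // in E3.
Qed.

Lemma fiber_derivative_coordE x (p : 'cV[R]_n) : chart_dom (chart_at c) x ->
  tangent_coord c x (fiber_derivative H x (cotangent_of_coord c x p)) =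
  p^T *m fiber_derivative_coord (chart_at c x).
Proof.
move=> cx.
(* [cotangent_of_coord c x] is dual to [tangent_coord c x], so this pairing reads off a [j]-th
   coordinate in the chart at [c]. *)
have key l j : pairing (cotangent_of_coord c x (delta_mx j 0))
    (fiber_derivative H x (cotangent_of_coord c x (delta_mx l 0))) =
    fiber_derivative_coord (chart_at c x) l j.
  rewrite fiber_derivativeP; last exact: hamiltonian_differentiable.
  rewrite mxE /derive1 /derive.
  set f := (X in lim (X @ _) = _); set g := (X in _ = lim (X @ _)).
  suff -> : f = g by [].
  apply/funext => h; rewrite /f /g /hamiltonian_coord /=.
  rewrite chart_funK // !addr0 scale0r addr0.
  rewrite -cotangent_of_coordDZ scaler0 add0r chart_funK //.
  by rewrite [_ + delta_mx l 0]addrC.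
have -> : tangent_coord c x (fiber_derivative H x (cotangent_of_coord c x p)) =
    p^T *m (\matrix_l tangent_coord c x (fiber_derivative H x
      (cotangent_of_coord c x (delta_mx l 0)))).
  rewrite [in LHS]tangent_coordE fiber_derivativeE cotangent_of_coordE.
  rewrite trmx_mul -!mulmxA; congr (_ *m _).
  apply/row_matrixP => l; rewrite rowK [RHS]tangent_coordE fiber_derivativeE.
  by rewrite cotangent_of_coordE trmx_mul trmx_delta -!mulmxA -rowE.
congr (_ *m _); apply/matrixP => l j; rewrite -key mxE.
by rewrite pairing_cotangent_of_coord -colE mxE.
Qed.

Lemma Ck_on_generator_coord m :
  Ck_on m (chart_cod (chart_at c)) generator_coord.
Proof.
have oc := chart_open_cod (chart_at c).
apply: Ck_on_mx => // i j.
rewrite (_ : (fun _ => _) = fun y => ('D_(delta_mx 0 i, 0)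
  (prod_expr (M := G) (N := M) (P := M) Phi e c c) (chart_at e e, y) : 'rV[R]_n) 0 j);
  last by apply/funext => y; rewrite mxE.
apply: Ck_on_coord => //.
have [_ /(_ (delta_mx 0 i, 0)) CD] := prod_expr_smooth (M := G) (N := M) (P := M)
  (f := Phi) Phi_smooth (act1 Phi_action c) m.+1.
apply: (Ck_on_comp _ oc _ _ _ CD).
- by apply: finite_coordinates_prod; exact: finite_coordinates_mx.
- exact: (open_prod_expr_dom (M := G) (N := M) (P := M) (f := Phi) Phi_smooth).
- move=> y cy; have dy := chart_invP cy.
  rewrite -[in X in (_, X)](chart_invK cy); apply: prod_expr_dom_chart => //.
    exact: chart_at_dom.
  by rewrite act1.
- by apply: Ck_on_pair => //; [exact: Ck_on_cst|exact: Ck_on_id].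
Qed.

Lemma Ck_on_fiber_derivative_coord m :
  Ck_on m (chart_cod (chart_at c)) fiber_derivative_coord.
Proof.
have oc := chart_open_cod (chart_at c).
apply: Ck_on_mx => // i j.
rewrite (_ : (fun _ => _) = fun y => 'D_(0, delta_mx j 0) hamiltonian_coord
  (y, delta_mx i 0)); last by apply/funext => y; rewrite mxE.
have [_ /(_ (0, delta_mx j 0)) CD] := H_smooth c m.+1.
apply: (Ck_on_comp _ oc _ _ _ CD).
- by apply: finite_coordinates_prod; exact: finite_coordinates_mx.
- by apply: open_setX => //; exact: openT.
- by move=> y cy; split.
- by apply: Ck_on_pair => //; [exact: Ck_on_id|exact: Ck_on_cst].
Qed.

Lemma generator_coord_free x : chart_dom (chart_at c) x ->
  row_free (generator_coord (chart_at c x)).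
Proof.
move=> cx; rewrite generator_coordE // /row_free mxrankMfree.
  exact: generator_mx_free.
by rewrite row_free_unit transition_mx_unit.
Qed.

Lemma Ck_on_mulmx m (A : set 'rV[R]_n) p q r (f : 'rV[R]_n -> 'M[R]_(p, q))
    (g : 'rV[R]_n -> 'M[R]_(q, r)) : open A ->
  Ck_on m A f -> Ck_on m A g -> Ck_on m A (fun y => f y *m g y).
Proof.
move=> oA Cf Cg; apply: Ck_on_mx => // i j.
rewrite (_ : (fun _ => _) = fun y => \sum_l f y i l * g y l j); last first.
  by apply/funext => y; rewrite mxE.
by apply: Ck_on_sum => // l _; apply: Ck_on_mul => //; exact: Ck_on_coord.
Qed.

End Local_frame.

(* If [A0 *m C = 1] and the columns of [N] form a basis of the kernel of [A0],
   then, as long as [A *m C] is invertible, those of [kernel_frame C N A] form a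
   basis of the kernel of [A]; their entries are polynomials in those of [A]. *)
Definition kernel_frame r (C : 'M[R]_(n, k)) (N : 'M[R]_(n, r))
    (A : 'M[R]_(k, n)) : 'M[R]_(n, r) :=
  \det (A *m C) *: N - C *m (\adj (A *m C) *m (A *m N)).

Lemma mul_kernel_frame r (C : 'M[R]_(n, k)) (N : 'M[R]_(n, r)) A :
  A *m kernel_frame C N A = 0.
Proof.
rewrite /kernel_frame mulmxBr -scalemxAr !mulmxA -[_ *m _ *m \adj _]/(_ *m _).
by rewrite mul_mx_adj mul_scalar_mx -scalemxAl subrr.
Qed.

(** The hypothesis on [w] reads [\det (A *m C) *: (N *m w) = C *m u]. Applying [A0] kills the left
    side and leaves [u], so [u = 0], and then [N *m w = 0]. *)
Lemma kernel_frame_inj r (C : 'M[R]_(n, k)) (N : 'M[R]_(n, r)) A0 A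
    (w : 'cV[R]_r) : A0 *m C = 1%:M -> A0 *m N = 0 -> row_free N^T ->
  \det (A *m C) != 0 -> kernel_frame C N A *m w = 0 -> w = 0.
Proof.
move=> A0C A0N Nfree detS; rewrite /kernel_frame mulmxBl -scalemxAl -!mulmxA.
move: (\adj _ *m _) => u /eqP; rewrite subr_eq0 => /eqP Nw.
have u0 : u = 0.
  have := congr1 (mulmx A0) Nw.
  by rewrite -scalemxAr !mulmxA A0N A0C mul0mx scaler0 mul1mx => /esym.
have {}Nw : N *m w = 0.
  move: Nw; rewrite u0 mulmx0 => /eqP; rewrite scaler_eq0 (negbTE detS) /=.
  by move/eqP.
apply: trmx_inj; rewrite trmx0; apply: (row_free_inj Nfree).
by rewrite /= -trmx_mul Nw trmx0 mul0mx.
Qed.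

Lemma smooth_horizontal : smooth_distribution (horizontal Phi H).
Proof.
exists (n - k)%N => c; set r := (n - k)%N.
have dc := chart_at_dom c; have oc := chart_open_cod (chart_at c).
set A := generator_coord c; pose A0 := A (chart_at c c).
have A0free : row_free A0 by exact: generator_coord_free.
(* [C] and [N] are chosen once, at the center [c]; only [A] varies in the frame. *)
have [C A0C] := row_freeP A0free.
have ker_rank x : chart_dom (chart_at c) x ->
    \rank (kermx (A (chart_at c x))^T) = r.
  by move=> cx; rewrite mxrank_ker mxrank_tr (eqP (generator_coord_free cx)).
have [N A0N Nfree] : exists2 N : 'M[R]_(n, r), A0 *m N = 0 & row_free N^T.
  rewrite -(ker_rank _ dc); exists (row_base (kermx A0^T))^T.
    apply: trmx_inj; rewrite trmx_mul trmxK trmx0.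
    by apply/sub_kermxP; rewrite eq_row_base.
  by rewrite trmxK; exact: row_base_free.
pose Q y := kernel_frame C N (A y).
pose V := [set y | chart_cod (chart_at c) y /\ \det (A y *m C) != 0].
pose U := [set x | chart_dom (chart_at c) x /\ V (chart_at c x)].
have CA m := Ck_on_generator_coord c m : Ck_on m (chart_cod (chart_at c)) A.
have CS m : Ck_on m (chart_cod (chart_at c)) (fun y => A y *m C).
  by apply: Ck_on_mulmx => //; exact: Ck_on_cst.
have CdetS m : Ck_on m (chart_cod (chart_at c)) (fun y => \det (A y *m C)).
  exact: Ck_on_det.
have CQ m : Ck_on m (chart_cod (chart_at c)) Q.
  apply: Ck_on_add => //; first by apply: Ck_on_scale => //; exact: Ck_on_cst.
  rewrite (_ : (fun _ => _) = fun y => (-1 : R) *: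
      (C *m (\adj (A y *m C) *m (A y *m N)))); last first.
    by apply/funext => y; rewrite scaleN1r.
  apply: Ck_on_scale => //; first exact: Ck_on_cst.
  apply: Ck_on_mulmx => //; first exact: Ck_on_cst.
  apply: Ck_on_mulmx => //; first exact: Ck_on_adj.
  by apply: Ck_on_mulmx => //; exact: Ck_on_cst.
have oV : open V.
  apply: (@open_map_preimage R _ _ (model_space 'rV[R]_n) (model_space R)
    (fun y => \det (A y *m C)) (chart_cod (chart_at c)) [set t | t != 0]) => //.
  exact: (CdetS 0%N).
have oU : open U.
  apply: (@open_map_preimage R _ _ M (model_space 'rV[R]_n) (chart_at c)
    (chart_dom (chart_at c)) V) => //; first exact: chart_open_dom.
  exact: chart_fun_continuous.
exists U, (fun i x => fiber_derivative H x
  (cotangent_of_coord c x (col i (Q (chart_at c x))))).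
split=> //.
- split=> //; split; first exact: chart_funP.
  by rewrite -/A0 A0C det1 oner_eq0.
- by move=> x [].
- move=> i m.
  have oW := open_chart_preimage c oU.
  have CF := Ck_on_fiber_derivative_coord c m.
  have CX : Ck_on m (chart_cod (chart_at c))
      (fun y => (col i (Q y))^T *m fiber_derivative_coord c y).
    apply: Ck_on_mulmx => //; apply: Ck_on_mx => // a b.
    rewrite (_ : (fun _ => _) = fun y => Q y b i); first exact: Ck_on_coord.
    by apply/funext => y; rewrite !mxE.
  apply: (eq_Ck_on oW) (sub_Ck_on _ CX) => [y /= [cy [dy _]]|y []//].
  have E := fiber_derivative_coordE (col i (Q y)) dy.
  by rewrite (chart_invK cy) in E *; exact: esym E.
move=> x [cx [_ detx]]; set F := \matrix_i _.
(* Combinations of the frame are images under FH of combinations of the columns of [Q], which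
   reduces its freeness and its span to statements on the kernel of [A]. *)
have FE (w : 'rV[R]_r) : w *m F =
    fiber_derivative H x (cotangent_of_coord c x (Q (chart_at c x) *m w^T)).
  rewrite fiber_derivativeE cotangent_of_coordE !trmx_mul trmxK -!mulmxA.
  congr (_ *m _); apply/row_matrixP => i.
  rewrite rowK fiber_derivativeE cotangent_of_coordE trmx_mul tr_col.
  by rewrite !row_mul mulmxA.
have zmP (p : 'cV[R]_n) : zero_momentum Phi x (cotangent_of_coord c x p) <->
    A (chart_at c x) *m p = 0.
  rewrite /A generator_coordE // -mulmxA -cotangent_of_coordE.
  exact: zero_momentumP.
have zmQ (w : 'rV[R]_r) : zero_momentum Phi x
    (cotangent_of_coord c x (Q (chart_at c x) *m w^T)).
  by apply/zmP; rewrite mulmxA mul_kernel_frame mul0mx.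
have Qinj (w : 'cV[R]_r) : Q (chart_at c x) *m w = 0 -> w = 0.
  exact: kernel_frame_inj A0C A0N Nfree detx.
have QTfree : row_free (Q (chart_at c x))^T.
  apply: inj_row_free => w /(congr1 trmx); rewrite trmx_mul trmxK trmx0.
  by move=> /Qinj /(congr1 trmx); rewrite trmxK trmx0.
have Tu := transition_mx_unit cx.
split.
  apply: inj_row_free => w; rewrite FE => w0.
  have : cotangent_of_coord c x (Q (chart_at c x) *m w^T) = 0.
    apply: FH_nondegenerate; first exact: zmQ.
      by apply/zero_momentumP; rewrite mulmx0.
    by rewrite w0 fiber_derivativeE trmx0 mul0mx.
  rewrite cotangent_of_coordE => /(congr1 (mulmx (invmx (transition_mx c x)))).
  rewrite mulKmx // mulmx0 => /Qinj /(congr1 trmx).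
  by rewrite trmxK trmx0.
apply/seteqP; split=> [v [alpha alpha0 <-]|v /submxP[w ->]] /=; last first.
  by rewrite FE; exists (cotangent_of_coord c x (Q (chart_at c x) *m w^T)).
pose p := invmx (transition_mx c x) *m alpha.
have alphaE : alpha = cotangent_of_coord c x p.
  by rewrite cotangent_of_coordE /p mulKVmx.
have Ap : A (chart_at c x) *m p = 0 by apply/zmP; rewrite -alphaE.
(* Both spaces have rank [r], so this inclusion is an equality and every zero momentum covector
   comes from the columns of [Q]. *)
have QA : ((Q (chart_at c x))^T <= kermx (A (chart_at c x))^T)%MS.
  by apply/sub_kermxP; rewrite -trmx_mul mul_kernel_frame trmx0.
have AQ : (kermx (A (chart_at c x))^T <= (Q (chart_at c x))^T)%MS.
  by rewrite -(mxrank_leqif_sup QA) ker_rank // (eqP QTfree).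
have /submxP[w pE] : (p^T <= (Q (chart_at c x))^T)%MS.
  by apply: submx_trans AQ; apply/sub_kermxP; rewrite -trmx_mul Ap trmx0.
apply/submxP; exists w; rewrite FE alphaE; congr fiber_derivative.
by congr cotangent_of_coord; rewrite -[p]trmxK pE trmx_mul trmxK.
Qed.

End Horizontal_distribution.

Theorem proposition4p2 (R : realType) (k n : nat)
    (G : lie_group R k) (M : smooth_manifold R n) (Phi : G -> M -> M)
    (H : forall x : M, cotangent x -> R)
    (Phi_action : left_action Phi) (Phi_smooth : smooth_action Phi)
    (Phi_free : free_action Phi) (Phi_proper : proper_action Phi)
    (H_smooth : smooth_hamiltonian H)
    (H_invariant : invariant_hamiltonian Phi H)
    (FH_linear : forall x : M, linear (fiber_derivative H x))
    (FH_nondegenerate : forall (x : M) (alpha beta : cotangent x),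
       zero_momentum Phi x alpha -> zero_momentum Phi x beta ->
       fiber_derivative H x alpha = fiber_derivative H x beta -> alpha = beta)
    (horizontal_vertical : forall x : M,
       horizontal Phi H x `&` vertical Phi x = [set 0]) :
  principal_connection Phi (horizontal Phi H).
Proof.
split; first exact: smooth_horizontal.
- exact: invariant_horizontal.
- by move=> x; exact: horizontal_vertical_sum.
Qed.
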